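(* Let $\mathcal{C}$ be a pivotal finite tensor category. For every pivotal left $\mathcal{C}$-module category $\mathcal{M}$, there is a symmetric Frobenius algebra $A$ in $\mathcal{C}$ such that $\mathcal{M}\approx\mathcal{C}_A$ as left $\mathcal{C}$-module categories, where $\mathcal{C}_A$ is the category of right $A$-modules in $\mathcal{C}$ with its natural left $\mathcal{C}$-module structure.
   Context: Let $k$ be a field. A finite abelian category is a $k$-linear category equivalent to the category of finite-dimensional left modules over a finite-dimensional $k$-algebra. A finite tensor category is a finite abelian category with a rigid monoidal structure whose tensor product is $k$-bilinear and whose unit object $1$ is simple. Monoidal and module categories are assumed strict. Left duals are $(X^*,\mathrm{ev}_X:X^*\otimes X\to 1,\mathrm{coev}_X:1\to X\otimes X^* )$, right duals are ${}^*X$ with $\mathrm{ev}'_X:X\otimes{}^*X\to 1$; they are chosen so that $(X\otimes Y)^*=Y^*\otimes X^*$, $1^*=1$ and $(-)^*$, ${}^*(-)$ are mutually inverse. A pivotal finite tensor category is a finite tensor category with an isomorphism $\mathfrak p:\mathrm{id}_{\mathcal C}\to(-)^{**}$ of tensor functors. A finite left $\mathcal{C}$-module category is a finite abelian category $\mathcal{M}$ with an action $\triangleright$ of $\mathcal{C}$ that is $k$-bilinear and right exact in each variable; it is exact if $P\triangleright M$ is projective for all projective $P\in\mathcal{C}$ and all $M\in\mathcal{M}$. Internal Hom: $[M,-]$ (written $\underline{\mathrm{Hom}}(M,-)$ in the literature) is a right adjoint of $\mathcal{C}\to\mathcal{M}$, $X\mapsto X\triangleright M$, with counit $\underline{\mathrm{ev}}_{M,N}:[M,N]\triangleright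 M\to N$; it is a functor $\mathcal M^{\mathrm{op}}\times\mathcal M\to\mathcal C$. The isomorphism $\mathfrak{a}_{X,M,N}:X\otimes[M,N]\to[M,X\triangleright N]$ corresponds under the adjunction to $X\triangleright\underline{\mathrm{ev}}_{M,N}$, and the isomorphism $\mathfrak{b}_{M,N,X}:[M,N]\otimes X\to[{}^*X\triangleright M,N]$ corresponds to $\underline{\mathrm{ev}}_{M,N}\circ(\mathrm{id}\triangleright\mathrm{ev}'_X\triangleright\mathrm{id}_M)$. A relative Serre functor of an exact $\mathcal{M}$ is a pair $(\mathbb{S},\phi)$ of a functor $\mathbb{S}:\mathcal M\to\mathcal M$ and a natural isomorphism $\phi_{M,N}:[N,\mathbb{S}(M)]\to[M,N]^*$ compatible with the right $\mathcal{C}$-module structures, i.e. $\phi_{M,{}^*Y\triangleright N}\circ\mathfrak b_{N,\mathbb S(M),Y}=(\mathfrak a_{{}^*Y,M,N}^{-1})^*\circ(\phi_{M,N}\otimes\mathrm{id}_Y)$ (using $[M,N]^*\otimes Y=({}^*Y\otimes[M,N])^*$). There is then a unique natural isomorphism $\xi_{X,M}:X^{**}\triangleright\mathbb{S}(M)\to\mathbb{S}(X\triangleright M)$ (the twisted $\mathcal{C}$-module structure of $\mathbb S$) such that $\phi_{X\triangleright M,N}\circ[N,\xi_{X,M}]\circ\mathfrak{a}_{X^{**},N,\mathbb{S}(M)}=(\mathfrak{b}_{M,N,X^*}^{-1})^*\circ(\mathrm{id}_{X^{**}}\otimes\phi_{M,N})$ (using $X^{**}\otimes[M,N]^*=([M,N]\otimes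 X^* )^*$). A relative Serre functor exists for every exact $\mathcal M$ and is unique up to isomorphism of twisted module functors. A pivotal structure of $\mathcal{M}$ is a natural isomorphism $\widetilde{\mathfrak p}:\mathrm{id}_{\mathcal M}\to\mathbb S$ with $\widetilde{\mathfrak p}_{X\triangleright M}=\xi_{X,M}\circ(\mathfrak p_X\triangleright\widetilde{\mathfrak p}_M)$ for all $X\in\mathcal C$, $M\in\mathcal M$. A pivotal left $\mathcal C$-module category is an exact left $\mathcal C$-module category endowed with a pivotal structure. A Frobenius algebra in $\mathcal{C}$ is a pair $(A,\lambda)$ of an algebra (monoid) $A$ in $\mathcal C$ with multiplication $\mu$ and a morphism $\lambda:A\to1$ such that $\psi:=(\lambda\mu\otimes\mathrm{id}_{A^*})\circ(\mathrm{id}_A\otimes\mathrm{coev}_A):A\to A^*$ is invertible. Its Nakayama automorphism is $\nu_A:=\psi^{-1}\circ\psi^*\circ\mathfrak p_A$, and it is symmetric if $\nu_A=\mathrm{id}_A$. *)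

(* Defs.v *)
From HB Require Import structures.
From mathcomp Require Import all_boot all_algebra.
From mathcomp Require Import boolp classical_sets.

Set Implicit Arguments.
Unset Strict Implicit.
Unset Printing Implicit Defensive.

Import GRing.Theory.
Local Open Scope ring_scope.

Declare Scope cat_scope.
Delimit Scope cat_scope with cat.
Local Open Scope cat_scope.

Record category (k : fieldType) := Category {
  ob :> Type;
  mor : ob -> ob -> lmodType k;
  idm : forall X : ob, mor X X;
  compm : forall X Y Z : ob, mor Y Z -> mor X Y -> mor X Z;
  compmA : forall (X Y Z W : ob) (h : mor Z W) (g : mor Y Z) (f : mor X Y),
    compm h (compm g f) = compm (compm h g) f;
  comp1m : forall (X Y : ob) (f : mor X Y), compm (idm Y) f = f;
  compm1 : forall (X Y : ob) (f : mor X Y), compm f (idm X) = f;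
  comp_linl : forall (X Y Z : ob) (a : k) (g g' : mor Y Z) (f : mor X Y),
    compm (a *: g + g') f = a *: compm g f + compm g' f;
  comp_linr : forall (X Y Z : ob) (a : k) (g : mor Y Z) (f f' : mor X Y),
    compm g (a *: f + f') = a *: compm g f + compm g f' }.

Arguments mor {k c} _ _.
Arguments idm {k c} _.
Arguments compm {k c X Y Z} _ _.

Notation "g \c f" := (compm g f) (at level 50, left associativity) : cat_scope.

(* Strictness of monoidal and module categories is equality of objects; the
   identity morphism read along an equality of objects is written [idto]. *)
Definition idto (k : fieldType) (C : category k) (X Y : C) (e : X = Y) :
    mor X Y :=
  match e in _ = Z return mor X Z with erefl => idm X end.

Section CategoryNotions.
Variables (k : fieldType) (C : category k).

Definition inverse_of (X Y : C) (f : mor X Y) (g : mor Y X) : Prop :=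
  g \c f = idm X /\ f \c g = idm Y.

Definition is_iso (X Y : C) (f : mor X Y) : Prop := exists g, inverse_of f g.

(* The inverse of an isomorphism; the value 0 at non-invertible morphisms is
   irrelevant. *)
Definition invm (X Y : C) (f : mor X Y) : mor Y X :=
  xget 0 [set g | inverse_of f g]%classic.

Definition mono (X Y : C) (f : mor X Y) : Prop :=
  forall (Z : C) (g h : mor Z X), f \c g = f \c h -> g = h.

Definition epi (X Y : C) (f : mor X Y) : Prop :=
  forall (Z : C) (g h : mor Y Z), g \c f = h \c f -> g = h.

Definition simple (X : C) : Prop :=
  idm X <> 0 /\
  forall (Y : C) (m : mor Y X), mono m -> m = 0 \/ is_iso m.

Definition projective (P : C) : Prop :=
  forall (X Y : C) (e : mor X Y) (f : mor P Y),
    epi e -> exists g : mor P X, e \c g = f.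

Definition is_cokernel (X Y Z : C) (f : mor X Y) (q : mor Y Z) : Prop :=
  q \c f = 0 /\
  forall (W : C) (h : mor Y W), h \c f = 0 -> exists! u : mor Z W, u \c q = h.

End CategoryNotions.

Record functor (k : fieldType) (C D : category k) := Functor {
  fob :> C -> D;
  fmap : forall X Y : C, mor X Y -> mor (fob X) (fob Y);
  fmap1 : forall X : C, fmap (idm X) = idm (fob X);
  fmapD : forall (X Y Z : C) (g : mor Y Z) (f : mor X Y),
    fmap (g \c f) = fmap g \c fmap f }.

Arguments fmap {k C D} f0 {X Y} _.

Definition linear_functor (k : fieldType) (C D : category k)
    (F : functor C D) : Prop :=
  forall (X Y : C) (a : k) (f g : mor X Y),
    fmap F (a *: f + g) = a *: fmap F f + fmap F g.

Definition right_exact (k : fieldType) (C D : category k)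
    (F : functor C D) : Prop :=
  forall (X Y Z : C) (f : mor X Y) (q : mor Y Z),
    is_cokernel f q -> is_cokernel (fmap F f) (fmap F q).

Definition id_functor (k : fieldType) (C : category k) : functor C C :=
  @Functor k C C (fun X => X) (fun _ _ f => f)
    (fun _ => erefl) (fun _ _ _ _ _ => erefl).

Section FunctorComposition.
Variables (k : fieldType) (C D E : category k).
Variables (G : functor D E) (F : functor C D).

Fact comp_functor1 (X : C) : fmap G (fmap F (idm X)) = idm (G (F X)).
Proof. by rewrite !fmap1. Qed.

Fact comp_functorD (X Y Z : C) (g : mor Y Z) (f : mor X Y) :
  fmap G (fmap F (g \c f)) = fmap G (fmap F g) \c fmap G (fmap F f).
Proof. by rewrite !fmapD. Qed.

Definition comp_functor : functor C E :=
  @Functor k C E (fun X => G (F X)) (fun _ _ f => fmap G (fmap F f))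
    comp_functor1 comp_functorD.

End FunctorComposition.

Definition natural_iso (k : fieldType) (C D : category k) (F G : functor C D)
    (eta : forall X : C, mor (F X) (G X)) : Prop :=
  (forall (X Y : C) (f : mor X Y), eta Y \c fmap F f = fmap G f \c eta X) /\
  (forall X : C, is_iso (eta X)).

Definition is_equivalence (k : fieldType) (C D : category k)
    (F : functor C D) : Prop :=
  exists G : functor D C,
    (exists eta, @natural_iso k C C (id_functor C) (comp_functor G F) eta) /\
    (exists eps, @natural_iso k D D (comp_functor F G) (id_functor D) eps).

Record subspace (k : fieldType) (V : lmodType k) := Subspace {
  in_subspace :> V -> Prop;
  subspace0 : in_subspace 0;
  subspace_lin : forall (a : k) (u v : V),
    in_subspace u -> in_subspace v -> in_subspace (a *: u + v) }.

Section SubspaceType.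
Variables (k : fieldType) (V : lmodType k) (S : subspace V).

Definition subspace_pred : {pred V} := fun v => `[< S v >].

Fact subspace_pred_closed : submod_closed subspace_pred.
Proof.
split; first by apply/asboolP/subspace0.
by move=> a u v /asboolP Su /asboolP Sv; apply/asboolP/subspace_lin.
Qed.

HB.instance Definition _ :=
  GRing.isSubmodClosed.Build k V subspace_pred 
    (GRing.submod_closed_semi subspace_pred_closed).

Definition subspace_type : Type := {v : V | v \in subspace_pred}.
HB.instance Definition _ := SubChoice.on subspace_type.
HB.instance Definition _ := [SubChoice_isSubLmodule of subspace_type by <:].

End SubspaceType.

(* [falgType k] is not used because it excludes the zero algebra. *)
Record fdAlgebra (k : fieldType) := FdAlgebra {
  alg_space :> vectType k;
  alg_mul : alg_space -> alg_space -> alg_space;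
  alg_one : alg_space;
  alg_mulA : forall x y z, alg_mul x (alg_mul y z) = alg_mul (alg_mul x y) z;
  alg_mul1l : forall x, alg_mul alg_one x = x;
  alg_mul1r : forall x, alg_mul x alg_one = x;
  alg_mul_linl : forall (a : k) x x' y,
    alg_mul (a *: x + x') y = a *: alg_mul x y + alg_mul x' y;
  alg_mul_linr : forall (a : k) x y y',
    alg_mul x (a *: y + y') = a *: alg_mul x y + alg_mul x y' }.

Record fdModule (k : fieldType) (A : fdAlgebra k) := FdModule {
  rep_space :> vectType k;
  rep_act : A -> rep_space -> rep_space;
  rep_actM : forall a b v, rep_act (alg_mul a b) v = rep_act a (rep_act b v);
  rep_act1 : forall v, rep_act (alg_one A) v = v;
  rep_act_linl : forall (c : k) a a' v,
    rep_act (c *: a + a') v = c *: rep_act a v + rep_act a' v;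
  rep_act_linr : forall (c : k) a v v',
    rep_act a (c *: v + v') = c *: rep_act a v + rep_act a v' }.

Section FdModules.
Variables (k : fieldType) (A : fdAlgebra k).

Section Hom.
Variables V W : fdModule A.

Definition rep_commutes (f : 'Hom(V, W)) : Prop :=
  forall (a : A) (v : V), f (rep_act a v) = rep_act a (f v).

Fact rep_commutes0 : rep_commutes 0.
Proof.
move=> a v; rewrite !lfunE /=.
by have := rep_act_linr (- 1) a (0 : W) 0; rewrite scaler0 addr0 scaleN1r addNr.
Qed.

Fact rep_commutes_lin (c : k) (f g : 'Hom(V, W)) :
  rep_commutes f -> rep_commutes g -> rep_commutes (c *: f + g).
Proof.
by move=> fA gA a v; rewrite !add_lfunE !scale_lfunE fA gA rep_act_linr.
Qed.

Definition rep_hom : lmodType k :=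
  subspace_type (Subspace rep_commutes0 rep_commutes_lin).

Definition rep_hom_fun (f : rep_hom) : 'Hom(V, W) := val f.

Fact rep_homP (f : rep_hom) : rep_commutes (rep_hom_fun f).
Proof. by apply/asboolP; exact: (valP f). Qed.

Definition RepHom (f : 'Hom(V, W)) (fA : rep_commutes f) : rep_hom :=
  exist _ f (asboolT fA).

Fact rep_hom_inj : injective rep_hom_fun.
Proof. exact: val_inj. Qed.

Fact rep_hom_fun_lin (c : k) (f g : rep_hom) :
  rep_hom_fun (c *: f + g) = c *: rep_hom_fun f + rep_hom_fun g.
Proof. by []. Qed.

End Hom.

Fact rep_id_commutes (V : fdModule A) : rep_commutes (\1%VF : 'Hom(V, V)).
Proof. by move=> a v; rewrite !lfunE. Qed.

Fact rep_comp_commutes (U V W : fdModule A) (g : rep_hom V W) (f : rep_hom U V) :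
  rep_commutes (rep_hom_fun g \o rep_hom_fun f)%VF.
Proof. by move=> a v; rewrite !lfunE /= !rep_homP. Qed.

Definition rep_id (V : fdModule A) : rep_hom V V := RepHom (@rep_id_commutes V).

Definition rep_comp (U V W : fdModule A) (g : rep_hom V W) (f : rep_hom U V) :
    rep_hom U W :=
  RepHom (rep_comp_commutes g f).

Definition fdModule_category : category k.
Proof.
refine (@Category k (fdModule A) rep_hom rep_id rep_comp _ _ _ _ _).
- by move=> X Y Z W h g f; apply: rep_hom_inj; exact: comp_lfunA.
- by move=> X Y f; apply: rep_hom_inj; exact: comp_lfun1l.
- by move=> X Y f; apply: rep_hom_inj; exact: comp_lfun1r.
- move=> X Y Z a g g' f; apply: rep_hom_inj; rewrite rep_hom_fun_lin /=.
  by rewrite /rep_hom_fun /= comp_lfunDl comp_lfunZl.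
- move=> X Y Z a g f f'; apply: rep_hom_inj; rewrite rep_hom_fun_lin /=.
  by rewrite /rep_hom_fun /= comp_lfunDr comp_lfunZr.
Defined.

End FdModules.

Definition finite_abelian (k : fieldType) (C : category k) : Prop :=
  exists (A : fdAlgebra k) (F : functor C (fdModule_category A)),
    linear_functor F /\ is_equivalence F.

Record monCategory (k : fieldType) := MonCategory {
  mon_cat :> category k;
  ten : mon_cat -> mon_cat -> mon_cat;
  tenm : forall X X' Y Y' : mon_cat,
    mor X X' -> mor Y Y' -> mor (ten X Y) (ten X' Y');
  tunit : mon_cat;
  tenm1 : forall X Y, tenm (idm X) (idm Y) = idm (ten X Y);
  tenmD : forall (X X' X'' Y Y' Y'' : mon_cat)
      (g : mor X' X'') (f : mor X X') (g' : mor Y' Y'') (f' : mor Y Y'),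
    tenm (g \c f) (g' \c f') = tenm g g' \c tenm f f';
  tenm_linl : forall (X X' Y Y' : mon_cat) (a : k)
      (f f' : mor X X') (g : mor Y Y'),
    tenm (a *: f + f') g = a *: tenm f g + tenm f' g;
  tenm_linr : forall (X X' Y Y' : mon_cat) (a : k)
      (f : mor X X') (g g' : mor Y Y'),
    tenm f (a *: g + g') = a *: tenm f g + tenm f g';
  tenA : forall X Y Z, ten (ten X Y) Z = ten X (ten Y Z);
  ten1l : forall X, ten tunit X = X;
  ten1r : forall X, ten X tunit = X;
  tenmA : forall (X X' Y Y' Z Z' : mon_cat)
      (f : mor X X') (g : mor Y Y') (h : mor Z Z'),
    idto (tenA X' Y' Z') \c tenm (tenm f g) h
    = tenm f (tenm g h) \c idto (tenA X Y Z);
  tenm1l : forall (X X' : mon_cat) (f : mor X X'),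
    idto (ten1l X') \c tenm (idm tunit) f = f \c idto (ten1l X);
  tenm1r : forall (X X' : mon_cat) (f : mor X X'),
    idto (ten1r X') \c tenm f (idm tunit) = f \c idto (ten1r X) }.

Arguments ten {k m} _ _.
Arguments tenm {k m X X' Y Y'} _ _.
Arguments tunit {k m}.
Arguments tenA {k m} _ _ _.
Arguments ten1l {k m} _.
Arguments ten1r {k m} _.

Notation "X \ten Y" := (ten X Y) (at level 40, left associativity) : cat_scope.
Notation "f \tenm g" := (tenm f g) (at level 40, left associativity) : cat_scope.

(* [ev_ten], [ev_one] and [evr_ev] say that [ld_ten], [ld_one] and [ld_rd] are
   equalities of duals, i.e. that the canonical isomorphisms between them are
   identities; together with the zig-zag identities they determine the
   coevaluations as well. *)
Record rigidCategory (k : fieldType) := RigidCategory {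
  rig_mon :> monCategory k;
  ld : rig_mon -> rig_mon;
  ev : forall X, mor (ld X \ten X) tunit;
  coev : forall X, mor tunit (X \ten ld X);
  ev_coev : forall X,
    idto (ten1r X) \c (idm X \tenm ev X) \c idto (tenA X (ld X) X)
      \c (coev X \tenm idm X)
    = idto (ten1l X);
  coev_ev : forall X,
    idto (ten1l (ld X)) \c (ev X \tenm idm (ld X))
      \c idto (esym (tenA (ld X) X (ld X))) \c (idm (ld X) \tenm coev X)
    = idto (ten1r (ld X));
  rd : rig_mon -> rig_mon;
  evr : forall X, mor (X \ten rd X) tunit;
  coevr : forall X, mor tunit (rd X \ten X);
  evr_coevr : forall X,
    idto (ten1l X) \c (evr X \tenm idm X) \c idto (esym (tenA X (rd X) X))
      \c (idm X \tenm coevr X)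
    = idto (ten1r X);
  coevr_evr : forall X,
    idto (ten1r (rd X)) \c (idm (rd X) \tenm evr X)
      \c idto (tenA (rd X) X (rd X)) \c (coevr X \tenm idm (rd X))
    = idto (ten1l (rd X));
  ld_ten : forall X Y, ld (X \ten Y) = ld Y \ten ld X;
  ld_one : ld tunit = tunit;
  ld_rd : forall X, ld (rd X) = X;
  rd_ld : forall X, rd (ld X) = X;
  ev_ten : forall X Y,
    ev (X \ten Y)
    = ev Y
      \c (idm (ld Y) \tenm (idto (ten1l Y) \c (ev X \tenm idm Y)
                             \c idto (esym (tenA (ld X) X Y))))
      \c idto (tenA (ld Y) (ld X) (X \ten Y))
      \c (idto (ld_ten X Y) \tenm idm (X \ten Y));
  ev_one : ev tunit = idto (ten1r tunit) \c (idto ld_one \tenm idm tunit);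
  evr_ev : forall X,
    evr X = ev (rd X) \c (idto (esym (ld_rd X)) \tenm idm (rd X)) }.

Arguments ld {k r} _.
Arguments ev {k r} _.
Arguments coev {k r} _.
Arguments rd {k r} _.
Arguments evr {k r} _.
Arguments coevr {k r} _.
Arguments ld_ten {k r} _ _.
Arguments ld_one {k r}.
Arguments ld_rd {k r} _.
Arguments rd_ld {k r} _.

Definition dualm (k : fieldType) (C : rigidCategory k) (X Y : C)
    (f : mor X Y) : mor (ld Y) (ld X) :=
  idto (ten1l (ld X)) \c (ev Y \tenm idm (ld X))
    \c idto (esym (tenA (ld Y) Y (ld X)))
    \c (idm (ld Y) \tenm (f \tenm idm (ld X)))
    \c (idm (ld Y) \tenm coev X)
    \c idto (esym (ten1r (ld Y))).

Record finTensorCategory (k : fieldType) := FinTensorCategory {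
  ftc_rigid :> rigidCategory k;
  ftc_finite : finite_abelian ftc_rigid;
  ftc_simple : simple (tunit : ftc_rigid) }.

Section PivotalStructure.
Variables (k : fieldType) (C : rigidCategory k).

Fact ldld_ten (X Y : C) : ld (ld (X \ten Y)) = ld (ld X) \ten ld (ld Y).
Proof. by rewrite !ld_ten. Qed.

Fact ldld_one : ld (ld tunit) = tunit :> C.
Proof. by rewrite !ld_one. Qed.

Record pivotal_structure := PivotalStructure {
  piv :> forall X : C, mor X (ld (ld X));
  piv_natural : forall (X Y : C) (f : mor X Y),
    piv Y \c f = dualm (dualm f) \c piv X;
  piv_iso : forall X : C, is_iso (piv X);
  piv_ten : forall X Y : C,
    idto (ldld_ten X Y) \c piv (X \ten Y) = piv X \tenm piv Y;
  piv_one : idto ldld_one \c piv tunit = idm tunit }.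

End PivotalStructure.

Record pivotalFTC (k : fieldType) := PivotalFTC {
  pft_ftc :> finTensorCategory k;
  pft_piv : pivotal_structure pft_ftc }.

Arguments pft_piv {k} _.

Record algebra (k : fieldType) (C : monCategory k) := Algebra {
  alg_ob :> C;
  mu : mor (alg_ob \ten alg_ob) alg_ob;
  eta : mor tunit alg_ob;
  muA : mu \c (mu \tenm idm alg_ob)
    = mu \c (idm alg_ob \tenm mu) \c idto (tenA alg_ob alg_ob alg_ob);
  mu1l : mu \c (eta \tenm idm alg_ob) = idto (ten1l alg_ob);
  mu1r : mu \c (idm alg_ob \tenm eta) = idto (ten1r alg_ob) }.

Arguments mu {k C} a.
Arguments eta {k C} a.

Section Frobenius.
Variables (k : fieldType) (C : rigidCategory k).
Variables (A : algebra C) (lambda : mor (alg_ob A) tunit).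

Definition frobenius_map : mor (alg_ob A) (ld A) :=
  idto (ten1l (ld A)) \c ((lambda \c mu A) \tenm idm (ld A))
    \c idto (esym (tenA (alg_ob A) A (ld A))) \c (idm (alg_ob A) \tenm coev A)
    \c idto (esym (ten1r (alg_ob A))).

Definition is_frobenius : Prop := is_iso frobenius_map.

Definition nakayama (p : pivotal_structure C) : mor (alg_ob A) A :=
  invm frobenius_map \c dualm frobenius_map \c p A.

Definition is_symmetric_frobenius (p : pivotal_structure C) : Prop :=
  is_frobenius /\ nakayama p = idm (alg_ob A).

End Frobenius.

Record modCategory (k : fieldType) (C : monCategory k) := ModCategory {
  mod_cat :> category k;
  act : C -> mod_cat -> mod_cat;
  actm : forall (X X' : C) (M M' : mod_cat),
    mor X X' -> mor M M' -> mor (act X M) (act X' M');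
  actm1 : forall X M, actm (idm X) (idm M) = idm (act X M);
  actmD : forall (X X' X'' : C) (M M' M'' : mod_cat)
      (g : mor X' X'') (f : mor X X') (g' : mor M' M'') (f' : mor M M'),
    actm (g \c f) (g' \c f') = actm g g' \c actm f f';
  actm_linl : forall (X X' : C) (M M' : mod_cat) (a : k)
      (f f' : mor X X') (g : mor M M'),
    actm (a *: f + f') g = a *: actm f g + actm f' g;
  actm_linr : forall (X X' : C) (M M' : mod_cat) (a : k)
      (f : mor X X') (g g' : mor M M'),
    actm f (a *: g + g') = a *: actm f g + actm f g';
  actA : forall X Y M, act (X \ten Y) M = act X (act Y M);
  act1 : forall M, act tunit M = M;
  actmA : forall (X X' Y Y' : C) (M M' : mod_cat)
      (f : mor X X') (g : mor Y Y') (h : mor M M'),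
    idto (actA X' Y' M') \c actm (f \tenm g) h
    = actm f (actm g h) \c idto (actA X Y M);
  act1m : forall (M M' : mod_cat) (f : mor M M'),
    idto (act1 M') \c actm (idm tunit) f = f \c idto (act1 M) }.

Arguments act {k C m} _ _.
Arguments actm {k C m X X' M M'} _ _.
Arguments actA {k C m} _ _ _.
Arguments act1 {k C m} _.

Notation "X \act M" := (act X M) (at level 41, right associativity) : cat_scope.
Notation "f \actm g" := (actm f g) (at level 41, right associativity) : cat_scope.

Section ActionFunctors.
Variables (k : fieldType) (C : monCategory k) (M : modCategory C).

Definition act_on (N : M) : functor C M.
Proof.
refine (@Functor k C M (fun X => X \act N)
  (fun X Y f => f \actm idm N) (fun X => actm1 X N) _).
by move=> X Y Z g f; rewrite -actmD comp1m.
Defined.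

Definition act_by (X : C) : functor M M.
Proof.
refine (@Functor k M M (fun N => X \act N)
  (fun N N' f => idm X \actm f) (fun N => actm1 X N) _).
by move=> N N' N'' g f; rewrite -actmD comp1m.
Defined.

Record finite_module_category : Prop := FiniteModuleCategory {
  fmc_finite : finite_abelian M;
  fmc_right_exactl : forall N : M, right_exact (act_on N);
  fmc_right_exactr : forall X : C, right_exact (act_by X) }.

Definition exact_module_category : Prop :=
  finite_module_category /\
  forall (P : C) (N : M), projective P -> projective (P \act N).

End ActionFunctors.

Definition module_equivalent (k : fieldType) (C : monCategory k)
    (M N : modCategory C) : Prop :=
  exists (F : functor M N)
         (s : forall (X : C) (L : M), mor (X \act F L) (F (X \act L))),
    [/\ linear_functor F,
        is_equivalence F,
        forall (X X' : C) (L L' : M) (f : mor X X') (g : mor L L'),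
          s X' L' \c (f \actm fmap F g) = fmap F (f \actm g) \c s X L,
        forall (X : C) (L : M), is_iso (s X L) &
        (forall (X Y : C) (L : M),
          fmap F (idto (actA X Y L)) \c s (X \ten Y) L
          = s X (Y \act L) \c (idm X \actm s Y L) \c idto (actA X Y (F L))) /\
        (forall L : M, fmap F (idto (act1 L)) \c s tunit L = idto (act1 (F L)))].

Record internal_hom (k : fieldType) (C : monCategory k) (M : modCategory C) :=
  InternalHom {
    iob : M -> M -> C;
    iev : forall N L : M, mor (iob N L \act N) L;
    icur : forall (X : C) (N L : M), mor (X \act N) L -> mor X (iob N L);
    iev_icur : forall (X : C) (N L : M) (f : mor (X \act N) L),
      iev N L \c (icur f \actm idm N) = f;
    icur_iev : forall (X : C) (N L : M) (g : mor X (iob N L)),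
      icur (iev N L \c (g \actm idm N)) = g }.

Arguments iob {k C M} i _ _.
Arguments iev {k C M} i _ _.
Arguments icur {k C M} i {X N L} _.

Section InternalHom.
Variables (k : fieldType) (C : rigidCategory k) (M : modCategory C).
Variable H : internal_hom M.

Definition imap (N N' L L' : M) (f : mor N N') (g : mor L L') :
    mor (iob H N' L) (iob H N L') :=
  icur H (g \c iev H N' L \c (idm (iob H N' L) \actm f)).

Definition ihom_a (X : C) (N L : M) :
    mor (X \ten iob H N L) (iob H N (X \act L)) :=
  icur H ((idm X \actm iev H N L) \c idto (actA X (iob H N L) N)).

Definition ihom_b (N L : M) (X : C) :
    mor (iob H N L \ten X) (iob H (rd X \act N) L) :=
  icur H (iev H N L
    \c (idm (iob H N L) \actm
          (idto (act1 N) \c (evr X \actm idm N) \c idto (esym (actA X (rd X) N))))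
    \c idto (actA (iob H N L) X (rd X \act N))).

Fact ld_ten_rd (V Y : C) : ld V \ten Y = ld (rd Y \ten V).
Proof. by rewrite ld_ten ld_rd. Qed.

Fact ldld_ten_ld (X V : C) : ld (ld X) \ten ld V = ld (V \ten ld X).
Proof. by rewrite ld_ten. Qed.

Fact rd_ld_act (X : C) (N : M) : rd (ld X) \act N = X \act N.
Proof. by rewrite rd_ld. Qed.

Record relative_serre := RelativeSerre {
  serre :> functor M M;
  serre_phi : forall N L : M, mor (iob H L (serre N)) (ld (iob H N L));
  serre_phi_natural : forall (N N' L L' : M) (f : mor N N') (g : mor L' L),
    serre_phi N' L' \c imap g (fmap serre f)
    = dualm (imap f g) \c serre_phi N L;
  serre_phi_iso : forall N L : M, is_iso (serre_phi N L);
  serre_phi_module : forall (N L : M) (Y : C),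
    serre_phi N (rd Y \act L) \c ihom_b L (serre N) Y
    = dualm (invm (ihom_a (rd Y) N L))
      \c idto (ld_ten_rd (iob H N L) Y) \c (serre_phi N L \tenm idm Y) }.

Record serre_module_structure (S : relative_serre) := SerreModuleStructure {
  xi :> forall (X : C) (N : M), mor (ld (ld X) \act S N) (S (X \act N));
  xi_natural : forall (X X' : C) (N N' : M) (f : mor X X') (g : mor N N'),
    xi X' N' \c (dualm (dualm f) \actm fmap S g)
    = fmap S (f \actm g) \c xi X N;
  xi_iso : forall (X : C) (N : M), is_iso (xi X N);
  xi_phi : forall (X : C) (N L : M),
    serre_phi S (X \act N) L \c imap (idm L) (xi X N)
      \c ihom_a (ld (ld X)) L (S N)
    = dualm (idto (f_equal (iob H ^~ L) (esym (rd_ld_act X N))))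
      \c dualm (invm (ihom_b N L (ld X)))
      \c idto (ldld_ten_ld X (iob H N L))
      \c (idm (ld (ld X)) \tenm serre_phi S N L) }.

Record module_pivotal_structure (p : pivotal_structure C) (S : relative_serre)
    (x : serre_module_structure S) := ModulePivotalStructure {
  mpiv :> forall N : M, mor N (S N);
  mpiv_natural : forall (N N' : M) (f : mor N N'),
    mpiv N' \c f = fmap S f \c mpiv N;
  mpiv_iso : forall N : M, is_iso (mpiv N);
  mpiv_act : forall (X : C) (N : M),
    mpiv (X \act N) = x X N \c (p X \actm mpiv N) }.

End InternalHom.

(* Internal Homs, the relative Serre functor and its twisted module structure
   exist for every exact module category and are unique up to
   isomorphism; recording a choice of them loses no generality. *)
Record pivotalModCategory (k : fieldType) (C : pivotalFTC k) :=
  PivotalModCategory {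
    pmc_mod :> modCategory C;
    pmc_exact : exact_module_category pmc_mod;
    pmc_ihom : internal_hom pmc_mod;
    pmc_serre : relative_serre pmc_ihom;
    pmc_xi : serre_module_structure pmc_serre;
    pmc_piv : module_pivotal_structure (pft_piv C) pmc_xi }.

Section Idto.
Variable k : fieldType.

Fact idto_irr (C : category k) (X Y : C) (e e' : X = Y) : idto e = idto e'.
Proof. by rewrite (Prop_irrelevance e e'). Qed.

Fact idto_id (C : category k) (X : C) (e : X = X) : idto e = idm X.
Proof. by rewrite (Prop_irrelevance e erefl). Qed.

Fact idto_comp (C : category k) (X Y Z : C) (e' : Y = Z) (e : X = Y) :
  idto e' \c idto e = idto (etrans e e').
Proof. by case: Z / e'; rewrite /= comp1m. Qed.

Fact tenm_idto (C : monCategory k) (X X' Y Y' : C) (e : X = X') (e' : Y = Y') :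
  idto e \tenm idto e' = idto (f_equal2 ten e e').
Proof. by case: X' / e; case: Y' / e'; rewrite tenm1 idto_id. Qed.

End Idto.

Section AlgebraModules.
Variables (k : fieldType) (C : monCategory k) (A : algebra C).

Record rmodule := RModule {
  rm_ob :> C;
  rm_act : mor (rm_ob \ten A) rm_ob;
  rm_actA : rm_act \c (rm_act \tenm idm (alg_ob A))
    = rm_act \c (idm rm_ob \tenm mu A) \c idto (tenA rm_ob A A);
  rm_act1 : rm_act \c (idm rm_ob \tenm eta A) = idto (ten1r rm_ob) }.

Fact rmodule_eq (V W : rmodule) (e : rm_ob V = rm_ob W) :
  idto e \c rm_act V = rm_act W \c (idto e \tenm idm (alg_ob A)) -> V = W.
Proof.
case: V W e => [V r rA r1] [W s sA s1] /= e; case: W / e s sA s1 => s sA s1.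
rewrite /= comp1m tenm1 compm1 => rs; case: s / rs sA s1 => sA s1.
by rewrite (Prop_irrelevance rA sA) (Prop_irrelevance r1 s1).
Qed.

Section Hom.
Variables V W : rmodule.

Definition rm_commutes (f : mor (rm_ob V) (rm_ob W)) : Prop :=
  f \c rm_act V = rm_act W \c (f \tenm idm (alg_ob A)).

Fact rm_commutes0 : rm_commutes 0.
Proof.
have comp0 X Y Z (f : mor X Y) : (0 : mor Y Z) \c f = 0 :> @mor k C X Z.
  by have := comp_linl (- 1) (0 : mor Y Z) 0 f; rewrite scaler0 addr0 scaleN1r addNr.
have comp0r X Y Z (f : mor Y Z) : f \c (0 : mor X Y) = 0 :> @mor k C X Z.
  by have := comp_linr (- 1) f (0 : mor X Y) 0; rewrite scaler0 addr0 scaleN1r addNr.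
rewrite /rm_commutes comp0.
have := tenm_linl (- 1) (0 : mor (rm_ob V) (rm_ob W)) 0 (idm (alg_ob A)).
by rewrite scaler0 addr0 scaleN1r addNr => ->; rewrite comp0r.
Qed.

Fact rm_commutes_lin (c : k) (f g : mor (rm_ob V) (rm_ob W)) :
  rm_commutes f -> rm_commutes g -> rm_commutes (c *: f + g).
Proof.
by rewrite /rm_commutes => fA gA; rewrite comp_linl tenm_linl comp_linr fA gA.
Qed.

Definition rm_hom : lmodType k :=
  subspace_type (Subspace rm_commutes0 rm_commutes_lin).

Definition rm_hom_val (f : rm_hom) : mor (rm_ob V) (rm_ob W) := val f.

Fact rm_homP (f : rm_hom) : rm_commutes (rm_hom_val f).
Proof. by apply/asboolP; exact: (valP f). Qed.

Definition RmHom (f : mor (rm_ob V) (rm_ob W)) (fA : rm_commutes f) : rm_hom :=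
  exist _ f (asboolT fA).

Fact rm_hom_inj : injective rm_hom_val.
Proof. exact: val_inj. Qed.

Fact rm_hom_val_lin (c : k) (f g : rm_hom) :
  rm_hom_val (c *: f + g) = c *: rm_hom_val f + rm_hom_val g.
Proof. by []. Qed.

End Hom.

Fact rm_id_commutes (V : rmodule) : @rm_commutes V V (idm (rm_ob V)).
Proof. by rewrite /rm_commutes tenm1 comp1m compm1. Qed.

Fact rm_comp_commutes (U V W : rmodule) (g : rm_hom V W) (f : rm_hom U V) :
  rm_commutes (rm_hom_val g \c rm_hom_val f).
Proof.
rewrite /rm_commutes -compmA (rm_homP f) compmA (rm_homP g) -compmA -tenmD.
by rewrite comp1m.
Qed.

Definition rmodule_category : category k.
Proof.
refine (@Category k rmodule rm_hom (fun V => RmHom (@rm_id_commutes V))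
  (fun U V W g f => RmHom (rm_comp_commutes g f)) _ _ _ _ _).
- by move=> X Y Z W h g f; apply: rm_hom_inj; exact: compmA.
- by move=> X Y f; apply: rm_hom_inj; exact: comp1m.
- by move=> X Y f; apply: rm_hom_inj; exact: compm1.
- by move=> X Y Z a g g' f; apply: rm_hom_inj; exact: comp_linl.
- by move=> X Y Z a g f f'; apply: rm_hom_inj; exact: comp_linr.
Defined.

Section Action.
Variables (X : C) (V : rmodule).

Definition rm_ten_act : mor ((X \ten V) \ten A) (X \ten V) :=
  (idm X \tenm rm_act V) \c idto (tenA X V A).

Fact rm_ten_actA :
  rm_ten_act \c (rm_ten_act \tenm idm (alg_ob A))
  = rm_ten_act \c (idm (X \ten V) \tenm mu A) \c idto (tenA (X \ten V) A A).
Proof.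
rewrite /rm_ten_act; set r := rm_act V; set a := idto (tenA X V A).
have -> : ((idm X \tenm r) \c a) \tenm idm (alg_ob A)
    = ((idm X \tenm r) \tenm idm (alg_ob A)) \c (a \tenm idm (alg_ob A)).
  by rewrite -tenmD comp1m.
rewrite compmA -[_ \c a \c (_ \tenm _)]compmA tenmA compmA -tenmD comp1m rm_actA.
rewrite -[_ \c a \c (_ \tenm _)]compmA -tenm1 tenmA compmA -tenmD comp1m.
have -> : idm X \tenm (r \c (idm (rm_ob V) \tenm mu A) \c idto (tenA (rm_ob V) A A))
    = (idm X \tenm (r \c (idm (rm_ob V) \tenm mu A)))
      \c (idm X \tenm idto (tenA (rm_ob V) A A)).
  by rewrite -tenmD comp1m.
rewrite -!compmA; congr (_ \c _); rewrite -[idm X]/(idto erefl).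
rewrite -[idm (alg_ob A)]/(idto erefl) !tenm_idto !idto_comp.
exact: idto_irr.
Qed.

Fact rm_ten_act1 :
  rm_ten_act \c (idm (X \ten V) \tenm eta A) = idto (ten1r (X \ten V)).
Proof.
rewrite /rm_ten_act -compmA -tenm1 tenmA compmA -tenmD comp1m rm_act1.
rewrite -[idm X]/(idto erefl) tenm_idto idto_comp; exact: idto_irr.
Qed.

Definition rm_ten : rmodule := RModule rm_ten_actA rm_ten_act1.

End Action.

Fact rm_tenm_commutes (X X' : C) (V V' : rmodule)
    (f : mor X X') (g : rm_hom V V') :
  @rm_commutes (rm_ten X V) (rm_ten X' V') (f \tenm rm_hom_val g).
Proof.
rewrite /rm_commutes /= /rm_ten_act -[RHS]compmA tenmA !compmA -!tenmD.
by rewrite comp1m compm1 (rm_homP g).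
Qed.

Definition rm_tenm (X X' : C) (V V' : rmodule)
    (f : mor X X') (g : rm_hom V V') : rm_hom (rm_ten X V) (rm_ten X' V') :=
  RmHom (rm_tenm_commutes f g).

Fact rm_tenA (X Y : C) (V : rmodule) :
  rm_ten (X \ten Y) V = rm_ten X (rm_ten Y V).
Proof.
apply: (@rmodule_eq (rm_ten (X \ten Y) V) (rm_ten X (rm_ten Y V)) (tenA X Y V)).
rewrite /= /rm_ten_act compmA -tenm1 tenmA -!compmA.
rewrite -{2}[idm X]comp1m tenmD -!compmA; congr (_ \c _).
rewrite -[idm X]/(idto erefl) -[idm (alg_ob A)]/(idto erefl).
by rewrite !tenm_idto !idto_comp; apply: idto_irr.
Qed.

Fact rm_ten1 (V : rmodule) : rm_ten tunit V = V.
Proof.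
apply: (@rmodule_eq (rm_ten tunit V) V (ten1l V)).
rewrite /= /rm_ten_act compmA tenm1l -compmA; congr (_ \c _).
rewrite -[idm (alg_ob A)]/(idto erefl).
by rewrite !tenm_idto !idto_comp; apply: idto_irr.
Qed.

Fact rm_hom_val_idto (V W : rmodule_category) (e : V = W) :
  rm_hom_val (idto e) = idto (f_equal rm_ob e).
Proof. by case: W / e. Qed.

Definition rmodules : modCategory C.
Proof.
refine (@ModCategory k C rmodule_category rm_ten rm_tenm
          _ _ _ _ rm_tenA rm_ten1 _ _).
- by move=> X V; apply: rm_hom_inj; exact: tenm1.
- by move=> X X' X'' V V' V'' g f g' f'; apply: rm_hom_inj; exact: tenmD.
- by move=> X X' V V' a f f' g; apply: rm_hom_inj; exact: tenm_linl.
- by move=> X X' V V' a f g g'; apply: rm_hom_inj; exact: tenm_linr.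
- move=> X X' Y Y' V V' f g h; apply: rm_hom_inj.
  change (rm_hom_val (@idto k rmodule_category _ _ (rm_tenA X' Y' V')) \c ((f \tenm g) \tenm rm_hom_val h)
    = (f \tenm (g \tenm rm_hom_val h)) \c rm_hom_val (@idto k rmodule_category _ _ (rm_tenA X Y V))).
  rewrite !rm_hom_val_idto (idto_irr _ (tenA X' Y' (rm_ob V'))).
  by rewrite (idto_irr (f_equal _ (rm_tenA X Y V)) (tenA X Y (rm_ob V))) tenmA.
- move=> V V' f; apply: rm_hom_inj.
  change (rm_hom_val (@idto k rmodule_category _ _ (rm_ten1 V')) \c (idm tunit \tenm rm_hom_val f)
    = rm_hom_val f \c rm_hom_val (@idto k rmodule_category _ _ (rm_ten1 V))).
  rewrite !rm_hom_val_idto (idto_irr _ (ten1l (rm_ob V'))).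
  by rewrite (idto_irr (f_equal _ (rm_ten1 V)) (ten1l (rm_ob V))) tenm1l.
Defined.

End AlgebraModules.

(* Main.v *)
Require Import Defs.
From HB Require Import structures.
From mathcomp Require Import all_boot all_algebra.
From mathcomp Require Import boolp classical_sets.

(** Let [G] be a progenerator of [M] and [A = [G, G]] its internal endomorphism
    algebra; the witness is [A] with a form read off from Serre duality.

    The equivalence. The functor [N |-> [G, N]] takes values in right
    [A]-modules, [A] acting by composition, and [ihom_a] makes it a module
    functor. It has the left adjoint [V |-> V \ten_A G], the cokernel [tens V]
    of the difference of the two maps [V \ten A \act G -> V \act G]. Exactness
    of [M] makes [[G, -]] preserve cokernels ([imap1_coker]), so it carries the
    presentation of [tens V] to the bar presentation of [V] by free modules,
    and the unit of the adjunction is invertible ([tens_unit_iso]). As [G]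
    is a generator, [[G, -]] reflects isomorphisms ([ihom_reflects_iso]), and
    with the triangle identity the counit is invertible too.

    The form. Composing the pivotal structure [G -> S G] with the Serre
    isomorphism gives [frob : [G, G] -> [G, S G] -> [G, G]^*]. That the Serre
    isomorphism respects the right [C]-module structures, combined with its
    naturality along the map [G -> rd A \act G] dual to the action of [A] on [G],
    makes [frob] a morphism of right [A]-modules ([ev_frob_act]); hence it is
    the Frobenius map of the form [a |-> frob 1 a] ([frobenius_map_frob]). That
    the pivotal structure respects the twisted left module structure, combined
    with naturality along the action [A \act G -> G] itself, makes [frob]
    left linear up to [p] ([frob_act_twisted]), which says that [frob] is equal
    to [dualm frob \c p A] ([frob_symmetric]): the Nakayama automorphism is
    trivial.

    Objects of a strict monoidal category are only propositionally associative,
    so computations are made with arrows, morphisms bundled with their ends, on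
    which the tensor product and the action are associative and unital on the
    nose. *)

Set Implicit Arguments.
Unset Strict Implicit.
Unset Printing Implicit Defensive.

Import GRing.Theory.
Local Open Scope ring_scope.
Local Open Scope cat_scope.

(** * Categorical generalities *)

Section CategoryFacts.
Variables (k : fieldType) (C : category k).

Lemma comp0m (X Y Z : C) (f : mor X Y) : (0 : mor Y Z) \c f = 0.
Proof.
by have := comp_linl (- 1) (0 : mor Y Z) 0 f; rewrite scaler0 addr0 scaleN1r addNr.
Qed.

Lemma compm0 (X Y Z : C) (g : mor Y Z) : g \c (0 : mor X Y) = 0.
Proof.
by have := comp_linr (- 1) g (0 : mor X Y) 0; rewrite scaler0 addr0 scaleN1r addNr.
Qed.

Lemma compmB (X Y Z : C) (g : mor Y Z) (f f' : mor X Y) :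
  g \c (f - f') = (g \c f) - (g \c f').
Proof. by rewrite addrC -scaleN1r comp_linr scaleN1r addrC. Qed.

Lemma iso_comp (X Y Z : C) (g : mor Y Z) (f : mor X Y) :
  is_iso g -> is_iso f -> is_iso (g \c f).
Proof.
move=> [g' [g'g gg']] [f' [f'f ff']]; exists (f' \c g'); split.
  by rewrite compmA -(compmA f') g'g compm1.
by rewrite compmA -(compmA g) ff' compm1.
Qed.

Lemma invmP (X Y : C) (f : mor X Y) : is_iso f -> inverse_of f (invm f).
Proof. by move=> [g fg]; apply: (@xgetPex _ 0 [set g | inverse_of f g]%classic); exists g. Qed.

Lemma invm_iso (X Y : C) (f : mor X Y) : is_iso f -> is_iso (invm f).
Proof. by move=> /invmP[? ?]; exists f. Qed.

Lemma invm_nat (X Y X' Y' : C) (f : mor X Y) (g : mor X' Y') (u : mor X X')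
    (v : mor Y Y') :
  is_iso f -> is_iso g -> g \c u = v \c f -> invm g \c v = u \c invm f.
Proof.
move=> /invmP[_ fK] /invmP[gK _] e.
by rewrite -[LHS]compm1 -fK compmA -(compmA _ v) -e !compmA gK comp1m.
Qed.

Lemma coker_epi (X Y Z : C) (f : mor X Y) (q : mor Y Z) :
  is_cokernel f q -> epi q.
Proof.
move=> [qf0 qU] W g h gh.
have [|u [_ uU]] := qU W (g \c q); first by rewrite -compmA qf0 compm0.
by rewrite -(uU g erefl) -(uU h (esym gh)).
Qed.

End CategoryFacts.

(** * Finite abelian categories *)

Section FdModuleFacts.
Variables (k : fieldType) (A : fdAlgebra k).

Lemma linear_lfun (V W : vectType k) (f : V -> W) :
  (forall a x y, f (a *: x + y) = a *: f x + f y) ->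
  exists g : 'Hom(V, W), g =1 f.
Proof.
move=> fL.
pose F : {linear V -> W} := HB.pack f (GRing.isLinear.Build _ _ _ _ f fL).
by exists (linfun F) => x; rewrite lfunE.
Qed.

Definition regular_module : fdModule A :=
  @FdModule k A (alg_space A) (@alg_mul k A)
    (fun a b v => esym (alg_mulA a b v)) (@alg_mul1l k A)
    (@alg_mul_linl k A) (@alg_mul_linr k A).

Lemma regular_hom (V : fdModule A) (v : V) :
  exists f : rep_hom regular_module V, rep_hom_fun f (alg_one A) = v.
Proof.
have [g gE] := @linear_lfun A V (fun a => rep_act a v)
  (fun c a a' => rep_act_linl c a a' v).
have gA : @rep_commutes k A regular_module V g.
  by move=> a b; rewrite !gE /= rep_actM.
by exists (RepHom gA); rewrite /rep_hom_fun /= gE rep_act1.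
Qed.

Lemma regular_hom_inj (V : fdModule A) (f g : rep_hom regular_module V) :
  rep_hom_fun f (alg_one A) = rep_hom_fun g (alg_one A) -> f = g.
Proof.
move=> fg; apply: rep_hom_inj; apply/lfunP => a.
rewrite -[a](alg_mul1r a) (rep_homP f a (alg_one A)) fg.
by rewrite -(rep_homP g a (alg_one A)).
Qed.

Definition stable (V : fdModule A) (U : {vspace V}) :=
  forall a v, v \in U -> rep_act a v \in U.

Lemma submodule (V : fdModule A) (U : {vspace V}) : stable U ->
  exists (S : fdModule A) (i : rep_hom S V),
    injective (rep_hom_fun i) /\ forall v, v \in U <-> exists s, rep_hom_fun i s = v.
Proof.
move=> Us.
pose ac (a : A) (s : subvs_of U) : subvs_of U := vsproj U (rep_act a (vsval s)).
have acE a s : vsval (ac a s) = rep_act a (vsval s).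
  by rewrite vsprojK // Us // subvsP.
have vsL c (s t : subvs_of U) : vsval (c *: s + t) = c *: vsval s + vsval t.
  exact: linearP.
have vsI : injective (@vsval k V U) by exact: val_inj.
pose S := @FdModule k A (subvs_of U) ac
  (fun a b s => ltac:(by apply: vsI; rewrite !acE rep_actM))
  (fun s => ltac:(by apply: vsI; rewrite acE rep_act1))
  (fun c a a' s => ltac:(by apply: vsI; rewrite vsL !acE rep_act_linl))
  (fun c a s s' => ltac:(by apply: vsI; rewrite vsL !acE vsL rep_act_linr)).
have [g gE] := @linear_lfun (subvs_of U) V vsval vsL.
have gA : @rep_commutes k A S V g by move=> a s; rewrite !gE acE.
exists S, (RepHom gA); split.
  by move=> s t; rewrite /rep_hom_fun /= !gE; apply: vsI.
move=> v; split=> [vU | [s <-]].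
  by exists (vsproj U v); rewrite /rep_hom_fun /= gE vsprojK.
by rewrite /rep_hom_fun /= gE subvsP.
Qed.

(** The quotient is carried by a complement of the submodule, on which
    [A] acts through the projection. *)
Lemma quotient_module (V : fdModule A) (U : {vspace V}) : stable U ->
  exists (Q : fdModule A) (q : rep_hom V Q),
    (forall w, exists v, rep_hom_fun q v = w) /\
    forall v, v \in U <-> rep_hom_fun q v = 0.
Proof.
move=> Us; pose W := (U^C)%VS.
have [p pE] := @linear_lfun V (subvs_of W) (fun v => vsproj W (v - projv U v))
  (fun a x y => ltac:(by rewrite -linearP /= linearP opprD addrACA -scalerN -scalerDr)).
have pval v : vsval (p v) = v - projv U v by rewrite pE vsprojK ?memv_projC.
have vsI : injective (@vsval k V W) by exact: val_inj.
have pW s : p (vsval s) = s.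
  apply: vsI; rewrite pval.
  have : vsval s \in lker (projv U) by rewrite lker_proj subvsP.
  by rewrite memv_ker => /eqP ->; rewrite subr0.
have pU v : v \in U <-> p v = 0.
  split=> [vU | /(congr1 vsval)].
    by apply: vsI; rewrite pval projv_id // subrr.
  by rewrite pval => /eqP; rewrite subr_eq0 => /eqP ->; exact: memv_proj.
have pac a v : p (rep_act a (vsval (p v))) = p (rep_act a v).
  have -> : rep_act a v = 1 *: rep_act a (v - projv U v) + rep_act a (projv U v).
    by rewrite -rep_act_linr scale1r subrK.
  rewrite (linearP p) /= !scale1r pval.
  by have /pU -> := Us a _ (memv_proj U v); rewrite addr0.
pose ac (a : A) (s : subvs_of W) : subvs_of W := p (rep_act a (vsval s)).
pose Q := @FdModule k A (subvs_of W) ac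
  (fun a b s => ltac:(by rewrite /ac pac rep_actM))
  (fun s => ltac:(by rewrite /ac rep_act1 pW))
  (fun c a a' s => ltac:(by rewrite /ac rep_act_linl linearP))
  (fun c a s s' => ltac:(by rewrite /ac linearP rep_act_linr linearP)).
have pA : @rep_commutes k A V Q p by move=> a v; rewrite /= /ac pac.
by exists Q, (RepHom pA); split=> // w; exists (vsval w); rewrite /rep_hom_fun /= pW.
Qed.

Lemma rep_linear (X Y : fdModule A) (f : rep_hom X Y) c x y :
  rep_hom_fun f (c *: x + y) = c *: rep_hom_fun f x + rep_hom_fun f y.
Proof. exact: linearP. Qed.

Section Hom.
Variables X Y : fdModule A.
Implicit Type f : rep_hom X Y.

Lemma limg_stable f : stable (limg (rep_hom_fun f)).
Proof. by move=> a _ /memv_imgP[x _ ->]; rewrite -rep_homP memv_img ?memvf. Qed.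

Lemma bij_rep_iso f :
  injective (rep_hom_fun f) -> (forall y, exists x, rep_hom_fun f x = y) ->
  is_iso (f : @mor k (fdModule_category A) X Y).
Proof.
move=> fI fS; have /choice[h hE] := fS.
have hL a x y : h (a *: x + y) = a *: h x + h y.
  by apply: fI; rewrite rep_linear !hE.
have [g gE] := linear_lfun hL.
have gA : rep_commutes (V := Y) (W := X) g.
  by move=> a v; apply: fI; rewrite rep_homP !gE !hE.
exists (RepHom gA); split; apply: rep_hom_inj; apply/lfunP => x /=;
  rewrite /rep_hom_fun /= comp_lfunE id_lfunE gE -/(rep_hom_fun f) ?hE //.
by apply: fI; rewrite hE.
Qed.

(** An arbitrary cokernel is known only up to isomorphism; the clause on vectors
    is what links epimorphisms and kernels back to linear algebra. *)
Lemma rep_coker_exists f :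
  exists (Z : fdModule A) (q : rep_hom Y Z),
    @is_cokernel k (fdModule_category A) X Y Z f q /\
    (forall y, rep_hom_fun q y = 0 -> exists x, rep_hom_fun f x = y).
Proof.
have [Q [q [qS qK]]] := quotient_module (@limg_stable f).
exists Q, q; split; last first.
  by move=> y /qK /memv_imgP[x _ ->]; exists x.
split.
  apply: rep_hom_inj; apply/lfunP => x /=.
  rewrite /rep_hom_fun /= comp_lfunE lfunE /= -/(rep_hom_fun f) -/(rep_hom_fun q).
  by apply/qK; rewrite memv_img ?memvf.
move=> W h hf0.
have hK y y' : rep_hom_fun q y = rep_hom_fun q y' -> rep_hom_fun h y = rep_hom_fun h y'.
  move=> e; have : y - y' \in limg (rep_hom_fun f).
    by apply/qK; rewrite linearB /= e subrr.
  case/memv_imgP=> x _ e'; apply/eqP; rewrite -subr_eq0 -linearB e'.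
  have := congr1 (fun u => rep_hom_fun u x) hf0.
  by rewrite /rep_hom_fun /= comp_lfunE lfunE /= => ->.
have /choice[t tE] := qS.
have tL a x y : rep_hom_fun h (t (a *: x + y))
    = a *: rep_hom_fun h (t x) + rep_hom_fun h (t y).
  by rewrite -rep_linear; apply: hK; rewrite rep_linear !tE.
have [g gE] := linear_lfun tL.
have gA : rep_commutes (V := Q) (W := W) g.
  by move=> a v; rewrite !gE -rep_homP; apply: hK; rewrite rep_homP !tE.
exists (RepHom gA); split.
  apply: rep_hom_inj; apply/lfunP => x /=.
  rewrite /rep_hom_fun /= comp_lfunE gE -/(rep_hom_fun q) -/(rep_hom_fun h).
  by apply: hK; rewrite tE.
move=> u uq; apply: rep_hom_inj; apply/lfunP => w.
by rewrite /rep_hom_fun /= gE -{2}[w]tE -uq comp_lfunE.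
Qed.

End Hom.

Lemma rep_epi_surj (X Y : fdModule_category A) (f : mor X Y) :
  epi f -> forall y, exists x, rep_hom_fun f x = y.
Proof.
move=> fE y; have [Z [q [[qf0 _] qK]]] := rep_coker_exists f.
apply: qK; rewrite (fE _ q 0) ?qf0 ?comp0m //.
by rewrite /rep_hom_fun /= lfunE.
Qed.

Lemma regular_projective : projective (regular_module : fdModule_category A).
Proof.
move=> X Y e f eE; have [x xE] := rep_epi_surj eE (rep_hom_fun f (alg_one A)).
have [g gE] := regular_hom x; exists g; apply: regular_hom_inj.
by rewrite /rep_hom_fun /= comp_lfunE -/(rep_hom_fun g) gE.
Qed.

Lemma regular_detects_iso (X Y : fdModule_category A) (f : mor X Y) :
  (forall g : mor (regular_module : fdModule_category A) Y, exists! h, f \c h = g) -> is_iso f.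
Proof.
move=> fU; apply: bij_rep_iso => [x y fxy | y].
  have [h hE] := regular_hom x; have [h' h'E] := regular_hom y.
  rewrite -hE -h'E; congr (rep_hom_fun _ _).
  have [u [_ uU]] := fU (f \c (h' : mor (regular_module : fdModule_category A) X)).
  rewrite -(uU h') // -(uU h) //; apply: regular_hom_inj.
  by rewrite /rep_hom_fun /= !comp_lfunE -/(rep_hom_fun h) -/(rep_hom_fun h') hE h'E.
have [g gE] := regular_hom y; have [h [hE _]] := fU g.
exists (rep_hom_fun h (alg_one A)).
by rewrite -gE -hE /rep_hom_fun /= comp_lfunE.
Qed.

(** Any cokernel of [f] is injective modulo the image of [f], so [t] lands in
    that image; the corestriction of [f] to its image is an epimorphism, along
    which [T] lifts. *)
Lemma rep_projective_lift (T X Y Z : fdModule_category A) (f : mor X Y)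
    (q : mor Y Z) (t : mor T Y) :
  projective T -> is_cokernel f q -> q \c t = 0 -> exists s : mor T X, f \c s = t.
Proof.
pose cat := fdModule_category A.
move=> Tp [qf0 qU] qt0.
have [Q [p [[pf0 _] pK]]] := rep_coker_exists f.
have [u [uq _]] := qU _ p pf0.
have [S [i [iI iE]]] := submodule (@limg_stable _ _ f).
have factor (V : fdModule_category A) (g : mor V Y) :
    (forall v, exists x, rep_hom_fun f x = rep_hom_fun g v) ->
    exists g' : mor V (S : cat), (i : mor (S : cat) Y) \c g' = g.
  move=> gf; have gS v : exists s, rep_hom_fun i s = rep_hom_fun g v.
    by apply/iE; have [x <-] := gf v; rewrite memv_img ?memvf.
  have /choice[h hE] := gS.
  have hL a x y : h (a *: x + y) = a *: h x + h y.
    by apply: iI; rewrite rep_linear !hE rep_linear.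
  have [g' g'E] := linear_lfun hL.
  have g'A : rep_commutes (V := V) (W := S) g'.
    by move=> a v; apply: iI; rewrite rep_homP !g'E !hE rep_homP.
  exists (RepHom g'A); apply: rep_hom_inj; apply/lfunP => v.
  by rewrite /rep_hom_fun /= comp_lfunE g'E -/(rep_hom_fun i) hE.
have [e eE] := factor X f (fun v => ex_intro _ v erefl).
have [|t' t'E] := factor T t.
  move=> v; apply: pK; rewrite -uq.
  have := congr1 (fun h => rep_hom_fun (u \c h) v) qt0.
  by rewrite compm0 compmA /rep_hom_fun /= !comp_lfunE lfunE /= => ->; rewrite ?lfunE.
have eE' : epi (e : mor X (S : fdModule_category A)).
  move=> W g h ghe; apply: rep_hom_inj; apply/lfunP => s.
  have [x xE] : exists x, rep_hom_fun f x = rep_hom_fun i s.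
    have /iE : exists s', rep_hom_fun i s' = rep_hom_fun i s by exists s.
    by case/memv_imgP => x _ ->; exists x.
  have -> : s = rep_hom_fun e x.
    by apply: iI; rewrite -xE -eE /rep_hom_fun /= comp_lfunE.
  have := congr1 (fun h => rep_hom_fun h x) ghe.
  by rewrite /rep_hom_fun /= !comp_lfunE.
have [s sE] := Tp _ _ _ t' eE'.
by exists s; rewrite -eE -compmA sE.
Qed.

End FdModuleFacts.

Lemma linear_fmap0 (k : fieldType) (C D : category k) (F : functor C D) :
  linear_functor F -> forall X Y : C, fmap F (0 : mor X Y) = 0.
Proof.
move=> FL X Y; have := FL X Y (- 1) 0 0.
by rewrite scaler0 addr0 scaleN1r addNr.
Qed.

Section Equivalence.
Variables (k : fieldType) (C D : category k) (F : functor C D).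
Hypothesis Feq : is_equivalence F.

Lemma equivalence_faithful (X Y : C) (f g : mor X Y) :
  fmap F f = fmap F g -> f = g.
Proof.
have [G [[e [eN eI]] _]] := Feq; move=> fg.
have [e' [e'e _]] := eI Y.
by rewrite -[f]comp1m -[g]comp1m -e'e -!compmA (eN _ _ f) (eN _ _ g) /= fg.
Qed.

Lemma equivalence_full (X Y : C) (h : mor (F X) (F Y)) :
  exists f, fmap F f = h.
Proof.
have [G [[e [eN eI]] [d [dN dI]]]] := Feq.
have Ginj (U V : D) (u v : mor U V) : fmap G u = fmap G v -> u = v.
  move=> uv; have [d' [_ dd']] := dI U.
  by rewrite -[u]compm1 -[v]compm1 -dd' !compmA -!(dN U V) /= uv.
have [e' [e'e ee']] := eI Y; have [x' [x'x xx']] := eI X.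
exists (e' \c fmap G h \c e X); apply: Ginj.
have := eN _ _ (e' \c fmap G h \c e X); rewrite /= !compmA ee' comp1m => E.
by rewrite -[LHS]compm1 -[RHS]compm1 -xx' !compmA E.
Qed.

Lemma equivalence_esurj (Y : D) :
  exists (X : C) (i : mor (F X) Y) (j : mor Y (F X)), inverse_of i j.
Proof.
have [G [_ [d [_ dI]]]] := Feq; have [j ji] := dI Y.
by exists (G Y), (d Y), j.
Qed.

Lemma equivalence_reflects_iso (X Y : C) (f : mor X Y) :
  is_iso (fmap F f) -> is_iso f.
Proof.
move=> [g [gf fg]]; have [h hE] := equivalence_full g.
by exists h; split; apply: equivalence_faithful; rewrite fmapD hE fmap1.
Qed.

Lemma equivalence_epi (X Y : C) (e : mor X Y) : epi e -> epi (fmap F e).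
Proof.
move=> eE W g h geh; have [W' [i [j [ji ij]]]] := equivalence_esurj W.
have [g' g'E] := equivalence_full (j \c g).
have [h' h'E] := equivalence_full (j \c h).
rewrite -[g]comp1m -[h]comp1m -ij -!compmA -g'E -h'E; congr (_ \c fmap F _).
apply: eE; apply: equivalence_faithful.
by rewrite !fmapD g'E h'E -!compmA geh.
Qed.

Lemma equivalence_projective (T : C) : projective T -> projective (F T).
Proof.
move=> Tp X Y e f eE.
have [X' [i [j [ji ij]]]] := equivalence_esurj X.
have [Y' [i' [j' [ji' ij']]]] := equivalence_esurj Y.
have [e' e'E] := equivalence_full (j' \c e \c i).
have [f' f'E] := equivalence_full (j' \c f).
have e'epi : epi e'.
  move=> W g h /(congr1 (fmap F)); rewrite !fmapD e'E !compmA => E.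
  have {}E : fmap F g \c j' \c e = fmap F h \c j' \c e.
    by rewrite -[LHS]compm1 -[RHS]compm1 -ij !compmA E.
  apply: equivalence_faithful; move/eE: E => E.
  by rewrite -[LHS]compm1 -[RHS]compm1 -ji' !compmA E.
have [g gE] := Tp _ _ e' f' e'epi.
exists (i \c fmap F g); rewrite -[LHS]comp1m -ij' -!compmA (compmA e) (compmA j').
by rewrite (compmA j' e) -e'E -fmapD gE f'E compmA ij' comp1m.
Qed.

Hypothesis Flin : linear_functor F.

Lemma equivalence_coker (X Y Z : C) (f : mor X Y) (q : mor Y Z) :
  is_cokernel f q <-> is_cokernel (fmap F f) (fmap F q).
Proof.
have F0 := linear_fmap0 Flin; split=> -[qf0 qU]; split.
- by rewrite -fmapD qf0 F0.
- move=> W h hf0; have [W' [i [j [ji ij]]]] := equivalence_esurj W.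
  have [h' h'E] := equivalence_full (j \c h).
  have [|u [uq uU]] := qU _ h'.
    by apply: equivalence_faithful; rewrite fmapD h'E -compmA hf0 compm0 F0.
  exists (i \c fmap F u); split; first by rewrite -compmA -fmapD uq h'E compmA ij comp1m.
  move=> v vq; have [v' v'E] := equivalence_full (j \c v).
  rewrite -[v]comp1m -ij -compmA -v'E (uU v') //.
  by apply: equivalence_faithful; rewrite fmapD v'E -compmA vq h'E.
- by apply: equivalence_faithful; rewrite fmapD qf0 F0.
move=> W h hf0; have [|u [uq uU]] := qU _ (fmap F h); first by rewrite -fmapD hf0 F0.
have [u' u'E] := equivalence_full u; exists u'; split.
  by apply: equivalence_faithful; rewrite fmapD u'E.
move=> v vq; apply: equivalence_faithful.
by rewrite u'E; apply: uU; rewrite -fmapD vq.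
Qed.

End Equivalence.

Lemma coker_comp_iso (k : fieldType) (C : category k) (X Y Z Z' : C)
    (f : mor X Y) (q : mor Y Z) (i : mor Z Z') :
  is_cokernel f q -> is_iso i -> is_cokernel f (i \c q).
Proof.
move=> [qf0 qU] [j [ji ij]]; split; first by rewrite -compmA qf0 compm0.
move=> W h /qU[u [uq uU]]; exists (u \c j); split.
  by rewrite compmA -(compmA u) ji compm1.
move=> v vq; rewrite (uU (v \c i)) -?compmA ?ij ?compm1 //.
Qed.

Section FiniteAbelian.
Variables (k : fieldType) (C : category k).
Hypothesis Cfin : finite_abelian C.

(** The sense of generator that is used below: [Hom(P, -)] is conservative. *)
Definition detects_iso (P : C) := forall (X Y : C) (f : mor X Y),
  (forall g : mor P Y, exists! h, f \c h = g) -> is_iso f.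

(** In a category of modules the regular module works: morphisms out of it are
    vectors, and epimorphisms are surjective. *)
Lemma progenerator_exists : exists P : C, projective P /\ detects_iso P.
Proof.
have [A [F [Flin Feq]]] := Cfin.
have [P [i [j [ji ij]]]] := equivalence_esurj Feq (regular_module A).
exists P; split.
  move=> X Y e f /(equivalence_epi Feq) eE.
  have [g gE] := regular_projective (fmap F f \c j) eE.
  have [g' g'E] := equivalence_full Feq (g \c i); exists g'.
  by apply: (equivalence_faithful Feq); rewrite fmapD g'E compmA gE -compmA ji compm1.
move=> X Y f fU; apply: (equivalence_reflects_iso Feq).
apply: regular_detects_iso => g.
have [g' g'E] := equivalence_full Feq (g \c i).
have [h' [h'E h'U]] := fU g'; exists (fmap F h' \c j); split.
  by rewrite compmA -fmapD h'E g'E -compmA ij compm1.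
move=> h hE; have [h'' h''E] := equivalence_full Feq (h \c i).
rewrite (h'U h'') ?h''E -?compmA ?ij ?compm1 //.
by apply: (equivalence_faithful Feq); rewrite fmapD h''E compmA hE g'E.
Qed.

Lemma coker_exists (X Y : C) (f : mor X Y) :
  exists (Z : C) (q : mor Y Z), is_cokernel f q.
Proof.
have [A [F [Flin Feq]]] := Cfin.
have [Z [q [qK _]]] := rep_coker_exists (fmap F f).
have [Z' [i [j [ji ij]]]] := equivalence_esurj Feq Z.
have [q' q'E] := equivalence_full Feq (j \c q : mor (F Y) (F Z')).
exists Z', q'; apply/(equivalence_coker Feq Flin); rewrite q'E.
by apply: coker_comp_iso qK _; exists i.
Qed.

Lemma projective_lift (T X Y Z : C) (f : mor X Y) (q : mor Y Z) (t : mor T Y) :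
  projective T -> is_cokernel f q -> q \c t = 0 -> exists s, f \c s = t.
Proof.
have [A [F [Flin Feq]]] := Cfin.
move=> /(equivalence_projective Feq) Tp /(equivalence_coker Feq Flin) qK qt0.
have [|s sE] := rep_projective_lift (t := fmap F t) Tp qK.
  by rewrite -fmapD qt0 linear_fmap0.
have [s' s'E] := equivalence_full Feq s; exists s'.
by apply: (equivalence_faithful Feq); rewrite fmapD s'E.
Qed.

(** Cokernels are detected by the exact functor represented by a
    progenerator: the comparison map from an actual cokernel is invertible. *)
Lemma coker_of_exact (P X Y Z : C) (f : mor X Y) (q : mor Y Z) :
  projective P -> detects_iso P ->
  q \c f = 0 ->
  (forall t : mor P Z, exists s, q \c s = t) ->
  (forall t : mor P Y, q \c t = 0 -> exists s, f \c s = t) ->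
  is_cokernel f q.
Proof.
move=> Pp Pd qf0 qS qK; have [Z' [q' q'K]] := coker_exists f.
have [u [uq _]] := q'K.2 _ q qf0.
rewrite -uq; apply: coker_comp_iso => //; apply: Pd => t.
have [s sE] := qS t; exists (q' \c s); split; first by rewrite compmA uq.
move=> h hE; have [s' s'E] := Pp _ _ q' h (coker_epi q'K).
have [|r rE] := qK (s' - s).
  by rewrite compmB sE -uq -compmA s'E hE subrr.
apply/eqP; rewrite -s'E eq_sym -subr_eq0 -compmB -rE compmA q'K.1 comp0m //.
Qed.

End FiniteAbelian.

(** * Calculus of arrows *)

(** A morphism together with its ends. On arrows, strictness becomes plain
    equality: all the coercions along equalities of objects disappear. *)
Record arrow (k : fieldType) (C : category k) := Arr {
  dom : C; cod : C; amor : mor dom cod }.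

Arguments Arr {k C dom cod} amor.

Definition ida (k : fieldType) (C : category k) (X : C) : arrow C := Arr (idm X).

Coercion ida : ob >-> arrow.

(** Composition is total: it is zero between ends that do not match, which
    keeps associativity unconditional. *)
Definition acomp (k : fieldType) (C : category k) (g f : arrow C) : arrow C :=
  Arr (match pselect (cod f = dom g) with
       | left e => amor g \c idto e \c amor f
       | right _ => 0
       end).

Notation "g \co f" := (acomp g f) (at level 50, left associativity) : cat_scope.

Section Arrows.
Variables (k : fieldType) (C : category k).
Implicit Types f g h : arrow C.

(** Equality proofs between objects are unique, so an equality of arrows with
    the same ends transports along nothing. *)
Lemma Arr_inj (X Y : C) (f g : mor X Y) : Arr f = Arr g -> f = g.
Proof.
move=> fg.
have gen (u v : arrow C) : u = v -> exists (e : dom u = dom v) (e' : cod u = cod v),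
    idto e' \c amor u = amor v \c idto e.
  by move=> ->; exists erefl, erefl; rewrite comp1m compm1.
have [e [e' /=]] := gen _ _ fg.
by rewrite !idto_id comp1m compm1.
Qed.

Lemma acompE (X Y Y' Z : C) (g : mor Y' Z) (f : mor X Y) (e : Y = Y') :
  Arr g \co Arr f = Arr (g \c idto e \c f).
Proof.
rewrite /acomp /=; case: pselect => [e' | []//].
by rewrite (idto_irr e' e).
Qed.

Lemma Arr_comp (X Y Z : C) (g : mor Y Z) (f : mor X Y) :
  Arr (g \c f) = Arr g \co Arr f.
Proof. by rewrite (acompE _ _ erefl) compm1. Qed.

Lemma Arr_idto (X Y : C) (e : X = Y) : Arr (idto e) = X.
Proof. by case: Y / e. Qed.

Lemma Arr_idtol (X Y Z : C) (e : Y = Z) (f : mor X Y) :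
  Arr (idto e \c f) = Arr f.
Proof. by case: Z / e; rewrite comp1m. Qed.

Lemma Arr_idtor (X Y Z : C) (e : X = Y) (f : mor Y Z) :
  Arr (f \c idto e) = Arr f.
Proof. by case: Y / e f => f; rewrite compm1. Qed.

Lemma Arr_idm (X : C) : Arr (idm X) = X.
Proof. by []. Qed.

Lemma acompA h g f : h \co (g \co f) = h \co g \co f.
Proof.
case: f g h => [X Y f] [Y' Z g] [Z' W h]; rewrite /acomp /=.
case: pselect => [e | ne]; case: pselect => [e' | ne'].
  by rewrite !compmA.
all: by rewrite ?(compm0, comp0m).
Qed.

Lemma acomp1 f (X : C) : dom f = X -> f \co X = f.
Proof. by case: f => Y Z f /= <-; rewrite -Arr_comp compm1. Qed.

Lemma acomp1l f (X : C) : cod f = X -> X \co f = f.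
Proof. by case: f => Y Z f /= <-; rewrite -Arr_comp comp1m. Qed.

End Arrows.

Definition arr_ten (k : fieldType) (C : monCategory k) (f g : arrow C) : arrow C :=
  Arr (amor f \tenm amor g).

Notation "f \ox g" := (arr_ten f g) (at level 40, left associativity) : cat_scope.

Definition arr_act (k : fieldType) (C : monCategory k) (M : modCategory C)
    (f : arrow C) (g : arrow M) : arrow M :=
  Arr (amor f \actm amor g).

Notation "f \ac g" := (arr_act f g) (at level 41, right associativity) : cat_scope.

Section Tensor.
Variables (k : fieldType) (C : monCategory k).
Implicit Types f g h : arrow C.

Lemma Arr_ten (X X' Y Y' : C) (f : mor X X') (g : mor Y Y') :
  Arr (f \tenm g) = Arr f \ox Arr g.
Proof. by []. Qed.

Lemma ida_ten (X Y : C) : ida (X \ten Y) = X \ox Y.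
Proof. by rewrite /ida -tenm1. Qed.

Lemma arr_tenA f g h : f \ox g \ox h = f \ox (g \ox h).
Proof.
case: f g h => [X X' f] [Y Y' g] [Z Z' h]; rewrite /arr_ten /=.
by rewrite -(Arr_idtol (tenA _ _ _)) tenmA Arr_idtor.
Qed.

Lemma arr_ten1l f : (tunit : C) \ox f = f.
Proof.
case: f => [X X' f]; rewrite /arr_ten /=.
by rewrite -(Arr_idtol (ten1l _)) tenm1l Arr_idtor.
Qed.

Lemma arr_ten1r f : f \ox (tunit : C) = f.
Proof.
case: f => [X X' f]; rewrite /arr_ten /=.
by rewrite -(Arr_idtol (ten1r _)) tenm1r Arr_idtor.
Qed.

Lemma arr_tenD g f g' f' : cod f = dom g -> cod f' = dom g' ->
  (g \co f) \ox (g' \co f') = (g \ox g') \co (f \ox f').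
Proof.
case: f g f' g' => [X Y f] [Y0 Z g] [X' Y' f'] [Y0' Z' g'] /= e e'.
case: Y0 / e g => g; case: Y0' / e' g' => g'.
by rewrite -!Arr_comp /arr_ten /= tenmD.
Qed.

Lemma arr_tenDr (X : C) g f : cod f = dom g ->
  X \ox (g \co f) = (X \ox g) \co (X \ox f).
Proof. by move=> e; rewrite -arr_tenD // acomp1. Qed.

Lemma arr_tenDl (X : C) g f : cod f = dom g ->
  (g \co f) \ox X = (g \ox X) \co (f \ox X).
Proof. by move=> e; rewrite -arr_tenD // acomp1. Qed.

End Tensor.

Section Action.
Variables (k : fieldType) (C : monCategory k) (M : modCategory C).
Implicit Types (f g h : arrow C) (u v : arrow M).

Lemma Arr_act (X X' : C) (N N' : M) (f : mor X X') (u : mor N N') :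
  Arr (f \actm u) = Arr f \ac Arr u.
Proof. by []. Qed.

Lemma ida_act (X : C) (N : M) : ida (X \act N) = X \ac N.
Proof. by rewrite /ida -actm1. Qed.

Lemma arr_actA f g u : (f \ox g) \ac u = f \ac g \ac u.
Proof.
case: f g u => [X X' f] [Y Y' g] [Z Z' u]; rewrite /arr_ten /arr_act /=.
by rewrite -(Arr_idtol (actA _ _ _)) actmA Arr_idtor.
Qed.

Lemma arr_act1 u : (tunit : C) \ac u = u.
Proof.
case: u => [X X' u]; rewrite /arr_act /=.
by rewrite -(Arr_idtol (act1 _)) act1m Arr_idtor.
Qed.

Lemma arr_actD g f v u : cod f = dom g -> cod u = dom v ->
  (g \co f) \ac (v \co u) = (g \ac v) \co (f \ac u).
Proof.
case: f g u v => [X Y f] [Y0 Z g] [X' Y' u] [Y0' Z' v] /= e e'.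
case: Y0 / e g => g; case: Y0' / e' v => v.
by rewrite -!Arr_comp /arr_act /= actmD.
Qed.

Lemma arr_actDr (X : C) v u : cod u = dom v ->
  ida X \ac (v \co u) = (ida X \ac v) \co (ida X \ac u).
Proof. by move=> e; rewrite -arr_actD // acomp1. Qed.

Lemma arr_actDl (N : M) g f : cod f = dom g ->
  (g \co f) \ac N = (g \ac N) \co (f \ac N).
Proof. by move=> e; rewrite -arr_actD // acomp1. Qed.

End Action.

(* The rules for identities along equalities of objects come first: they must
   fire before [Arr_comp] splits the composite they occur in. *)
Definition arrE := (Arr_idtol, Arr_idtor, Arr_comp, Arr_ten, Arr_act, Arr_idto, Arr_idm).

(* Decides the matching of ends in a composite, up to strictness. *)
Ltac ends :=
  by rewrite /= ?(tenA, ten1l, ten1r, ld_ten, ld_one, ld_rd, rd_ld, actA, act1).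

Section Slides.
Variables (k : fieldType) (C : monCategory k).

(** Interchange, in the two orders in which morphisms on different strands can
    be applied. *)
Lemma tenLR (f g : arrow C) (X Y : C) : dom f = X -> cod g = Y ->
  (f \ox Y) \co (X \ox g) = f \ox g.
Proof. by move=> <- <-; rewrite -arr_tenD // acomp1 // acomp1l. Qed.

Lemma tenRL (f g : arrow C) (X Y : C) : cod f = X -> dom g = Y ->
  (X \ox g) \co (f \ox Y) = f \ox g.
Proof. by move=> <- <-; rewrite -arr_tenD // acomp1 // acomp1l. Qed.

Lemma actLR (M : modCategory C) (f : arrow C) (u : arrow M) (X : C) (N : M) :
  dom f = X -> cod u = N -> (f \ac N) \co (ida X \ac u) = f \ac u.
Proof. by move=> <- <-; rewrite -arr_actD // acomp1 // acomp1l. Qed.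

Lemma actRL (M : modCategory C) (f : arrow C) (u : arrow M) (X : C) (N : M) :
  cod f = X -> dom u = N -> (ida X \ac u) \co (f \ac N) = f \ac u.
Proof. by move=> <- <-; rewrite -arr_actD // acomp1 // acomp1l. Qed.

(** A morphism into or out of the unit occupies no strand at one of its ends,
    so it can be created before or after any other morphism. *)
Section UnitSlides.
Variables X Y Z : C.
Implicit Type g : mor Y Z.

Lemma coev_slide (s : mor tunit X) g :
  (Arr s \ox Z) \co Arr g = (X \ox Arr g) \co (Arr s \ox Y).
Proof. by rewrite -{1}[Arr g]arr_ten1l tenLR // tenRL. Qed.

Lemma coev_slider (s : mor tunit X) g :
  (Z \ox Arr s) \co Arr g = (Arr g \ox X) \co (Y \ox Arr s).
Proof. by rewrite -{1}[Arr g]arr_ten1r tenRL // tenLR. Qed.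

Lemma ev_slide (s : mor X tunit) g :
  Arr g \co (Arr s \ox Y) = (Arr s \ox Z) \co (X \ox Arr g).
Proof. by rewrite -{1}[Arr g]arr_ten1l tenRL // tenLR. Qed.

Lemma ev_slider (s : mor X tunit) g :
  Arr g \co (Y \ox Arr s) = (Z \ox Arr s) \co (Arr g \ox X).
Proof. by rewrite -{1}[Arr g]arr_ten1r tenLR // tenRL. Qed.

Variables (M : modCategory C) (N L : M).

Lemma act_coev_slide (s : mor tunit X) (u : mor N L) :
  (Arr s \ac L) \co Arr u = (ida X \ac Arr u) \co (Arr s \ac N).
Proof. by rewrite -{1}[Arr u]arr_act1 actLR // actRL. Qed.

Lemma act_ev_slide (s : mor X tunit) (u : mor N L) :
  Arr u \co (Arr s \ac N) = (Arr s \ac L) \co (ida X \ac Arr u).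
Proof. by rewrite -{1}[Arr u]arr_act1 actRL // actLR. Qed.

End UnitSlides.

End Slides.

(** * Duals *)

Section Duals.
Variables (k : fieldType) (C : rigidCategory k).
Implicit Types f g : arrow C.

Lemma zig_ev (X : C) : (X \ox Arr (ev X)) \co (Arr (coev X) \ox X) = X.
Proof. by have := congr1 Arr (ev_coev X); rewrite !arrE => ->; rewrite ten1l. Qed.

Lemma zag_ev (X : C) : (Arr (ev X) \ox ld X) \co (ld X \ox Arr (coev X)) = ld X.
Proof. by have := congr1 Arr (coev_ev X); rewrite !arrE => ->; rewrite ten1r. Qed.

Lemma zig_evr (X : C) : (Arr (evr X) \ox X) \co (X \ox Arr (coevr X)) = X.
Proof. by have := congr1 Arr (evr_coevr X); rewrite !arrE => ->; rewrite ten1r. Qed.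

Lemma zag_evr (X : C) : (rd X \ox Arr (evr X)) \co (Arr (coevr X) \ox rd X) = rd X.
Proof. by have := congr1 Arr (coevr_evr X); rewrite !arrE => ->; rewrite ten1l. Qed.

(** [ld X] represents [Z |-> Hom(Z \ten X, 1)]; identities between morphisms
    into a dual are checked after evaluation. *)
Lemma dual_ext (X : C) f g : dom f = dom g -> cod f = ld X -> cod g = ld X ->
  Arr (ev X) \co (f \ox X) = Arr (ev X) \co (g \ox X) -> f = g.
Proof.
suff name h : cod h = ld X -> h
    = ((Arr (ev X) \co (h \ox X)) \ox ld X) \co (dom h \ox Arr (coev X)).
  by move=> efg ef eg E; rewrite (name f ef) (name g eg) E efg.
move=> e; rewrite arr_tenDl; last by rewrite /= e.
rewrite -acompA arr_tenA -ida_ten tenLR //=.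
rewrite -(tenRL (f := h) (X := ld X) (Y := tunit)) // arr_ten1r acompA zag_ev.
by rewrite acomp1l.
Qed.

Lemma ev_dualm (X Y : C) (f : mor X Y) :
  Arr (ev X) \co (Arr (dualm f) \ox X) = Arr (ev Y) \co (ld Y \ox Arr f).
Proof.
rewrite /dualm !arrE !arr_tenDl; try ends.
rewrite !arr_tenA.
have exch : Arr (ev X) \co (Arr (ev Y) \ox (ld X \ox X))
    = Arr (ev Y) \co (ld Y \ox (Y \ox Arr (ev X))).
  rewrite -{1}[Arr (ev X)]arr_ten1l -[ld X \ox X]ida_ten tenRL //.
  rewrite -[Arr (ev Y) in RHS]arr_ten1r -arr_tenA -[ld Y \ox Y]ida_ten.
  by rewrite tenLR.
rewrite !acompA exch -!acompA; congr (_ \co _).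
rewrite -!arr_tenDr; try ends; congr (_ \ox _).
rewrite acompA -[ld X \ox X]ida_ten tenRL // -(tenLR (X := X) (Y := tunit)) //.
by rewrite -acompA zig_ev arr_ten1r acomp1.
Qed.

Lemma dualm_comp (X Y Z : C) (g : mor Y Z) (f : mor X Y) :
  dualm (g \c f) = dualm f \c dualm g.
Proof.
apply: Arr_inj; apply: (dual_ext (X := X)) => //.
rewrite ev_dualm (Arr_comp g) (Arr_comp (dualm f)) arr_tenDl // acompA ev_dualm -acompA.
rewrite tenRL // -(tenLR (f := Arr (dualm g)) (X := ld Z) (Y := Y)) // acompA ev_dualm.
by rewrite -acompA -arr_tenDr.
Qed.

Lemma dualm1 (X : C) : dualm (idm X) = idm (ld X).
Proof.
apply: Arr_inj; apply: (dual_ext (X := X)) => //.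
by rewrite ev_dualm.
Qed.

Lemma Arr_evr (X : C) : Arr (evr X) = Arr (ev (rd X)).
Proof.
by rewrite evr_ev !arrE -ida_ten acomp1 //= ld_rd.
Qed.

Lemma Arr_evr_ld (X : C) : Arr (evr (ld X)) = Arr (ev X).
Proof. by rewrite Arr_evr rd_ld. Qed.

Lemma Arr_ev_ten (X Y : C) :
  Arr (ev (X \ten Y)) = Arr (ev Y) \co (ld Y \ox (Arr (ev X) \ox Y)).
Proof.
rewrite ev_ten !arrE -ida_ten acomp1 //=; ends.
Qed.

End Duals.

(** * Internal Homs *)

Section InternalHom.
Variables (k : fieldType) (C : monCategory k) (M : modCategory C).
Variable H : internal_hom M.

Definition evA (N L : M) : arrow M := Arr (iev H N L).

(** The uniqueness half of the adjunction, for arrows whose ends may be equal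
    without being syntactically the same. *)
Lemma hom_ext (N L : M) (f g : arrow C) :
  dom f = dom g -> cod f = iob H N L -> cod g = iob H N L ->
  evA N L \co (f \ac N) = evA N L \co (g \ac N) -> f = g.
Proof.
case: f g => [X Y f] [X' Y' g] /= eX eY eY'.
case: X' / eX g => g; case: _ / (esym eY) f => f; case: _ / (esym eY') g => g E.
rewrite -(icur_iev f) -(icur_iev g); congr (Arr (icur H _)).
by apply: Arr_inj; rewrite !Arr_comp.
Qed.

Lemma evA_icur (X : C) (N L : M) (f : mor (X \act N) L) :
  evA N L \co (Arr (icur H f) \ac N) = Arr f.
Proof. by rewrite -Arr_act -Arr_comp iev_icur. Qed.

End InternalHom.

Section InternalHomRigid.
Variables (k : fieldType) (C : rigidCategory k) (M : modCategory C).
Variable H : internal_hom M.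
Local Notation evA := (evA H).
Local Notation "[ N , L ]" := (iob H N L).

Lemma evA_imap (N N' L L' : M) (f : mor N N') (g : mor L L') :
  evA N L' \co (Arr (imap H f g) \ac N)
  = Arr g \co evA N' L \co (ida [N', L] \ac Arr f).
Proof. by rewrite evA_icur !arrE. Qed.

Lemma evA_a (X : C) (N L : M) :
  evA N (X \act L) \co (Arr (ihom_a H X N L) \ac N) = ida X \ac evA N L.
Proof. by rewrite evA_icur !arrE. Qed.

Lemma evA_b (N L : M) (X : C) :
  evA (rd X \act N) L \co (Arr (ihom_b H N L X) \ac (rd X \act N))
  = evA N L \co (ida [N, L] \ac Arr (evr X) \ac N).
Proof. by rewrite evA_icur !arrE. Qed.

(** The transpose [c] of a map out of [ld X \ten [N, X \act L]], bent back with the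
    coevaluation of [X], is inverse to [ihom_a]. *)
Lemma ihom_a_iso (X : C) (N L : M) : is_iso (ihom_a H X N L).
Proof.
pose c := icur H (idto (act1 L) \c (ev X \actm idm L) \c idto (esym (actA _ _ _))
   \c (idm (ld X) \actm iev H N (X \act L)) \c idto (actA (ld X) [N, X \act L] N)).
have cE : evA N L \co (Arr c \ac N)
    = (Arr (ev X) \ac L) \co (ida (ld X) \ac evA N (X \act L)).
  by rewrite evA_icur !arrE.
pose b := (idm X \tenm c) \c idto (tenA _ _ _) \c (coev X \tenm idm [N, X \act L])
   \c idto (esym (ten1l _)).
have bE : Arr b = (X \ox Arr c) \co (Arr (coev X) \ox [N, X \act L]).
  by rewrite /b !arrE.
exists b; split; apply: Arr_inj; rewrite Arr_comp bE Arr_idm.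
  have cK : Arr c \co (ld X \ox Arr (ihom_a H X N L)) = Arr (ev X) \ox [N, L].
    apply: (hom_ext (H := H) (N := N) (L := L)) => //=; try ends.
    rewrite arr_actDl // acompA cE arr_actA -acompA -arr_actDr // evA_a.
    rewrite -arr_actA -ida_ten arr_actA -ida_act.
    by rewrite (act_ev_slide (ev X) (iev H N L)).
  rewrite -acompA (coev_slide (coev X) (ihom_a H X N L)) !ida_ten arr_tenA acompA.
  by rewrite -arr_tenDr ?cK -?arr_tenA -?arr_tenDl ?zig_ev //; ends.
apply: (hom_ext (H := H) (N := N) (L := X \act L)) => //=; try ends.
rewrite arr_actDl; last ends.
rewrite acompA evA_a arr_actDl; last ends.
rewrite arr_actA acompA -arr_actDr // cE arr_actDr; last ends.
rewrite -acompA -!arr_actA.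
rewrite -ida_ten (arr_actA _ _ (ida N)) -ida_act.
rewrite -(act_coev_slide (coev X) (iev H N (X \act L))) !ida_act acompA.
by rewrite -arr_actA -arr_actDl ?zig_ev -?ida_act ?acomp1l ?acomp1 //; ends.
Qed.

(** As for [ihom_a], bending the strand of [X] to the other side with the right
    dual. *)
Lemma ihom_b_iso (N L : M) (X : C) : is_iso (ihom_b H N L X).
Proof.
pose c := icur H (iev H (rd X \act N) L \c idto (actA [rd X \act N, L] (rd X) N)).
have cE : evA N L \co (Arr c \ac N) = evA (rd X \act N) L by rewrite evA_icur !arrE.
pose b := (c \tenm idm X) \c idto (esym (tenA _ _ _))
  \c (idm [rd X \act N, L] \tenm coevr X) \c idto (esym (ten1r _)).
have bE : Arr b = (Arr c \ox X) \co ([rd X \act N, L] \ox Arr (coevr X)).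
  by rewrite /b !arrE.
exists b; split; apply: Arr_inj; rewrite Arr_comp bE Arr_idm.
  have cK : Arr c \co (Arr (ihom_b H N L X) \ox rd X) = [N, L] \ox Arr (evr X).
    apply: (hom_ext (H := H) (N := N) (L := L)) => //=; try ends.
    rewrite arr_actDl // acompA cE arr_actA -ida_act evA_b.
    by rewrite !arr_actA.
  rewrite -acompA (coev_slider (coevr X) (ihom_b H N L X)) !ida_ten -arr_tenA acompA.
  by rewrite -arr_tenDl ?cK ?arr_tenA -?arr_tenDr ?zig_evr //; ends.
apply: (hom_ext (H := H) (N := rd X \act N) (L := L)) => //=; try ends.
rewrite arr_actDl; last ends.
rewrite acompA evA_b arr_actDl; last ends.
rewrite !arr_actA !ida_act.
have -> : ida X \ac ida (rd X) \ac ida N = (X \ten rd X) \act N.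
  by rewrite -arr_actA -ida_ten -ida_act.
rewrite acompA -(acompA (evA N L)) actRL //.
rewrite -(actLR (f := Arr c) (X := [rd X \act N, L] \ten rd X) (N := N)); try ends.
rewrite acompA cE -acompA ida_ten arr_actA -arr_actDr; last ends.
rewrite -(arr_actA (rd X)) -(arr_actA (Arr (coevr X))) -arr_actDl; last ends.
by rewrite zag_evr.
Qed.

End InternalHomRigid.

(** * The algebra of internal endomorphisms and its modules *)

Section InternalEnd.
Variables (k : fieldType) (C : rigidCategory k) (M : modCategory C).
Variables (H : internal_hom M) (G : M).
Local Notation evA := (evA H).
Local Notation "[ N , L ]" := (iob H N L).

Lemma evA_inj (X : C) (N L : M) (f g : mor X [N, L]) :
  evA N L \co (Arr f \ac N) = evA N L \co (Arr g \ac N) -> f = g.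
Proof. by move=> E; apply: Arr_inj; apply: hom_ext E. Qed.

(** Composition of internal Homs; at [N = G] it multiplies [[G, G]]. *)
Definition ihom_act (N : M) : mor ([G, N] \ten [G, G]) [G, N] :=
  icur H (iev H G N \c (idm [G, N] \actm iev H G G) \c idto (actA [G, N] [G, G] G)).

Definition ihom_unit : mor tunit [G, G] := icur H (idto (act1 G)).

Lemma evA_act (N : M) :
  evA G N \co (Arr (ihom_act N) \ac G) = evA G N \co (ida [G, N] \ac evA G G).
Proof. by rewrite evA_icur !arrE. Qed.

Lemma evA_unit : evA G G \co (Arr ihom_unit \ac G) = G.
Proof. by rewrite evA_icur !arrE act1. Qed.

Lemma ihom_actA (N : M) :
  ihom_act N \c (ihom_act N \tenm idm [G, G])
  = ihom_act N \c (idm [G, N] \tenm ihom_act G) \c idto (tenA [G, N] [G, G] [G, G]).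
Proof.
apply: evA_inj; rewrite !arrE !arr_actDl //; try ends.
rewrite !acompA evA_act -!acompA !arr_actA -!arr_actDr // evA_act.
rewrite -ida_act actRL // -(actLR (X := [G, N] \ten [G, G]) (N := G)) //.
by rewrite acompA evA_act -acompA ida_ten arr_actA -arr_actDr.
Qed.

Lemma ihom_act1 (N : M) :
  ihom_act N \c (idm [G, N] \tenm ihom_unit) = idto (ten1r [G, N]).
Proof.
apply: evA_inj; rewrite !arrE arr_actDl; last ends.
by rewrite acompA evA_act -acompA arr_actA -arr_actDr ?evA_unit ?ten1r //; ends.
Qed.

Lemma ihom_act1l : ihom_act G \c (ihom_unit \tenm idm [G, G]) = idto (ten1l [G, G]).
Proof.
apply: evA_inj; rewrite !arrE arr_actDl; last ends.
rewrite acompA evA_act -acompA arr_actA -ida_act.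
rewrite -(act_coev_slide ihom_unit (iev H G G)) acompA evA_unit ten1l.
by rewrite -ida_act acomp1 // acomp1l.
Qed.

Definition end_algebra : algebra C :=
  Algebra (ihom_actA G) ihom_act1l (ihom_act1 G).

Definition ihom_module (N : M) : rmodule end_algebra :=
  @RModule k C end_algebra [G, N] (ihom_act N) (ihom_actA N) (ihom_act1 N).

Lemma evA_imap1 (N N' : M) (f : mor N N') :
  evA G N' \co (Arr (imap H (idm G) f) \ac G) = Arr f \co evA G N.
Proof. by rewrite evA_imap -ida_act acomp1. Qed.

Lemma imap1 (N : M) : imap H (idm G) (idm N) = idm [G, N].
Proof.
by apply: evA_inj; rewrite evA_imap1 -ida_act acomp1 // acomp1l.
Qed.

Lemma imap1D (N N' N'' : M) (g : mor N' N'') (f : mor N N') :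
  imap H (idm G) (g \c f) = imap H (idm G) g \c imap H (idm G) f.
Proof.
apply: evA_inj; rewrite evA_imap1 (Arr_comp (imap _ _ g)) arr_actDl //.
by rewrite acompA evA_imap1 -acompA evA_imap1 acompA -Arr_comp.
Qed.

Lemma imap1_commutes (N N' : M) (f : mor N N') :
  @rm_commutes k C end_algebra (ihom_module N) (ihom_module N') (imap H (idm G) f).
Proof.
apply: evA_inj; rewrite !arrE !arr_actDl //.
rewrite !acompA evA_imap1 evA_act -acompA evA_act arr_actA -ida_act -acompA.
rewrite actRL // -(actLR (f := Arr (imap _ _ _)) (X := [G, N]) (N := G)) //.
by rewrite [in RHS]acompA evA_imap1 -!acompA.
Qed.

Definition ihom_functor : functor M (rmodules end_algebra).
Proof.
refine (@Functor k M (rmodules end_algebra) ihom_module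
  (fun N N' f => RmHom (@imap1_commutes N N' f)) _ _).
- by move=> N; apply: rm_hom_inj; exact: imap1.
- by move=> N N' N'' g f; apply: rm_hom_inj; exact: imap1D.
Defined.

Lemma imap1_linear (N N' : M) (a : k) (f g : mor N N') :
  imap H (idm G) (a *: f + g) = a *: imap H (idm G) f + imap H (idm G) g.
Proof.
rewrite -[RHS](icur_iev (i := H)); congr (icur H _).
have imapE u : iev H G N' \c (imap H (idm G) u \actm idm G) = u \c iev H G N.
  by rewrite iev_icur actm1 compm1.
have -> : (a *: imap H (idm G) f + imap H (idm G) g) \actm idm G
    = a *: (imap H (idm G) f \actm idm G) + (imap H (idm G) g \actm idm G).
  exact: actm_linl.
by rewrite comp_linr !imapE actm1 compm1 comp_linl.
Qed.

Lemma ihom_functor_linear : linear_functor ihom_functor.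
Proof. by move=> N N' a f g; apply: rm_hom_inj; exact: imap1_linear. Qed.

Lemma ihom_a_natural (X X' : C) (N N' : M) (f : mor X X') (g : mor N N') :
  ihom_a H X' G N' \c (f \tenm imap H (idm G) g)
  = imap H (idm G) (f \actm g) \c ihom_a H X G N.
Proof.
apply: evA_inj; rewrite !arrE !arr_actDl //.
rewrite !acompA evA_a evA_imap1 -acompA evA_a arr_actA.
rewrite -arr_actD // acomp1l // evA_imap1 Arr_act -arr_actD //.
by rewrite acomp1.
Qed.

Lemma ihom_a_commutes (X : C) (N : M) :
  @rm_commutes k C end_algebra (rm_ten X (ihom_module N)) (ihom_module (X \act N))
    (ihom_a H X G N).
Proof.
apply: evA_inj; rewrite /= /rm_ten_act !arrE !arr_actDl //; try ends.
rewrite !acompA evA_a evA_act -acompA !arr_actA -arr_actDr // evA_act.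
rewrite -[in RHS]ida_act actRL //.
rewrite -(actLR (f := Arr (ihom_a _ _ _ _)) (X := X \ten [G, N]) (N := G)) //.
by rewrite acompA evA_a ida_ten arr_actA -arr_actDr.
Qed.

Lemma ihom_aA (X Y : C) (N : M) :
  imap H (idm G) (idto (actA X Y N)) \c ihom_a H (X \ten Y) G N
  = ihom_a H X G (Y \act N) \c (idm X \tenm ihom_a H Y G N) \c idto (tenA X Y [G, N]).
Proof.
apply: evA_inj; rewrite !arrE !arr_actDl //; try ends.
rewrite !acompA evA_imap1 -[in LHS]acompA evA_a Arr_idto ida_ten arr_actA.
rewrite acomp1l; last ends.
by rewrite evA_a arr_actA -arr_actDr // evA_a.
Qed.

Lemma ihom_a1 (N : M) :
  imap H (idm G) (idto (act1 N)) \c ihom_a H tunit G N = idto (ten1l [G, N]).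
Proof.
apply: evA_inj; rewrite !arrE !arr_actDl //.
rewrite acompA evA_imap1 -acompA evA_a Arr_idto arr_act1.
by rewrite acomp1l ?act1 // ten1l -ida_act acomp1.
Qed.

Lemma rm_iso (V W : rmodules end_algebra) (f : mor V W) :
  is_iso (rm_hom_val f) -> is_iso f.
Proof.
move=> [g [gf fg]].
have gA : @rm_commutes k C end_algebra W V g.
  rewrite /rm_commutes -[LHS]compm1 -tenm1.
  have -> : idm (rm_ob W) \tenm idm [G, G]
      = (rm_hom_val f \tenm idm [G, G]) \c (g \tenm idm [G, G]).
    by rewrite -tenmD fg comp1m.
  by rewrite compmA -(compmA g) -(rm_homP f) !compmA gf comp1m.
by exists (RmHom gA); split; apply: rm_hom_inj.
Qed.

Definition ihom_structure (X : C) (N : M) :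
    mor (X \act ihom_functor N) (ihom_functor (X \act N)) :=
  RmHom (ihom_a_commutes X N).

End InternalEnd.

(** * Module categories as categories of modules *)

Section Morita.
Variables (k : fieldType) (C : rigidCategory k) (M : modCategory C).
Variables (H : internal_hom M) (G : M).
Local Notation evA := (evA H).
Local Notation "[ N , L ]" := (iob H N L).
Local Notation A := (end_algebra H G).
Local Notation Hom_G := (ihom_functor H G).

Hypothesis Cfin : finite_abelian C.
Hypothesis Mfin : finite_abelian M.
Hypothesis Mexact : forall (P : C) (N : M), projective P -> projective (P \act N).
Hypothesis Gdet : detects_iso G.

Lemma imap1_icur (X : C) (N L : M) (s : mor (X \act G) N) (g : mor N L) :
  imap H (idm G) g \c icur H s = icur H (g \c s).
Proof.
apply: evA_inj; rewrite evA_icur Arr_comp arr_actDl // acompA evA_imap1.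
by rewrite -acompA evA_icur Arr_comp.
Qed.

Lemma icur_surjective (X : C) (N : M) (s : mor X [G, N]) :
  exists t : mor (X \act G) N, icur H t = s.
Proof. by exists (iev H G N \c (s \actm idm G)); rewrite icur_iev. Qed.

Lemma icur_injective (X : C) (N L : M) : injective (@icur k C M H X N L).
Proof. by move=> s t st; rewrite -(@iev_icur k C M H _ _ _ s) st iev_icur. Qed.

Lemma imap1_0 (N L : M) : imap H (idm G) (0 : mor N L) = 0.
Proof.
by have := imap1_linear H G (- 1) (0 : mor N L) 0; rewrite scaler0 addr0 scaleN1r addNr.
Qed.

Lemma imap1B (N L : M) (f g : mor N L) :
  imap H (idm G) (f - g) = imap H (idm G) f - imap H (idm G) g.
Proof. by rewrite addrC -scaleN1r imap1_linear scaleN1r addrC. Qed.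

Lemma icur0 (X : C) (N : M) : icur H (0 : mor (X \act G) N) = 0.
Proof.
by rewrite -[in RHS](comp0m _ (icur H (0 : mor (X \act G) N))) -(imap1_0 N N) imap1_icur compm0.
Qed.

(** For projective [P] the object [P \act G] is projective, so
    [Hom(P, [G, -])], which is [Hom(P \act G, -)], is exact; a progenerator [P]
    detects cokernels. *)
Lemma imap1_coker (X Y Z : M) (f : mor X Y) (q : mor Y Z) :
  is_cokernel f q -> is_cokernel (imap H (idm G) f) (imap H (idm G) q).
Proof.
move=> qK; have [P [Pp Pd]] := progenerator_exists Cfin.
apply: (coker_of_exact Cfin Pp Pd).
- by rewrite -imap1D qK.1 imap1_0.
- move=> t; have [t' <-] := icur_surjective t.
  have [s <-] := @Mexact P G Pp _ _ _ t' (coker_epi qK).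
  by exists (icur H s); rewrite imap1_icur.
move=> t; have [t' <-] := icur_surjective t; rewrite imap1_icur => qt0.
have [|s <-] := projective_lift Mfin (@Mexact P G Pp) qK (t := t').
  by apply: icur_injective; rewrite qt0 icur0.
by exists (icur H s); rewrite imap1_icur.
Qed.

(** The object [V \ten_A G] of [M], the quotient of [V \act G] that identifies
    the two actions of [A]. *)
Section TensorOver.

Definition act_diff (V : rmodules A) : mor ((rm_ob V \ten A) \act G) (rm_ob V \act G) :=
  (rm_act V \actm idm G) - ((idm (rm_ob V) \actm iev H G G) \c idto (actA (rm_ob V) A G)).

Definition balanced (V : rmodules A) (N : M) (h : mor (rm_ob V \act G) N) :=
  Arr h \co (Arr (rm_act V) \ac G) = Arr h \co (ida (rm_ob V) \ac evA G G).

Lemma balancedP (V : rmodules A) (N : M) (h : mor (rm_ob V \act G) N) :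
  balanced h <-> h \c act_diff V = 0.
Proof.
have E : Arr (h \c ((idm (rm_ob V) \actm iev H G G) \c idto (actA (rm_ob V) A G)))
    = Arr h \co (ida (rm_ob V) \ac evA G G).
  by rewrite Arr_comp (Arr_comp (_ \actm _)) Arr_idto !arrE acomp1 //= actA.
rewrite /balanced -E compmB; split=> [e | /eqP e].
  by apply/eqP; rewrite subr_eq0; apply/eqP/Arr_inj; rewrite -e !arrE.
by move: e; rewrite subr_eq0 => /eqP <-; rewrite !arrE.
Qed.

Definition tens_sig (V : rmodules A) := cid (coker_exists Mfin (act_diff V)).
Definition tens (V : rmodules A) : M := projT1 (tens_sig V).
Definition tens_sig2 (V : rmodules A) := cid (projT2 (tens_sig V)).
Definition tensq (V : rmodules A) : mor (rm_ob V \act G) (tens V) :=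
  projT1 (tens_sig2 V).

Lemma tensqP (V : rmodules A) : is_cokernel (act_diff V) (tensq V).
Proof. exact: projT2 (tens_sig2 V). Qed.

Lemma tensq_balanced (V : rmodules A) : balanced (tensq V).
Proof. by apply/balancedP; case: (tensqP V). Qed.

Lemma tensq_epi (V : rmodules A) : epi (tensq V).
Proof. exact: coker_epi (tensqP V). Qed.

Lemma tens_desc_exists (V : rmodules A) (N : M) (h : mor (rm_ob V \act G) N) :
  balanced h -> exists u, u \c tensq V = h.
Proof. by move=> /balancedP /((tensqP V).2 N)[u [uq _]]; exists u. Qed.

Definition tens_desc (V : rmodules A) (N : M) (h : mor (rm_ob V \act G) N)
    (hb : balanced h) : mor (tens V) N := projT1 (cid (tens_desc_exists hb)).

Lemma tens_descE (V : rmodules A) (N : M) (h : mor (rm_ob V \act G) N)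
    (hb : balanced h) : tens_desc hb \c tensq V = h.
Proof. exact: projT2 (cid (tens_desc_exists hb)). Qed.

Lemma tensm_balanced (V W : rmodules A) (f : mor V W) :
  balanced (tensq W \c (rm_hom_val f \actm idm G)).
Proof.
rewrite /balanced !arrE -!acompA -arr_actDl //.
rewrite -Arr_comp (rm_homP f) Arr_comp arr_actDl //= acompA.
rewrite (tensq_balanced W) -acompA Arr_ten arr_actA -ida_act actRL //.
by rewrite -(actLR (X := rm_ob V) (N := G)).
Qed.

Definition tensm (V W : rmodules A) (f : mor V W) : mor (tens V) (tens W) :=
  tens_desc (tensm_balanced f).

Lemma tensmE (V W : rmodules A) (f : mor V W) :
  tensm f \c tensq V = tensq W \c (rm_hom_val f \actm idm G).
Proof. exact: tens_descE. Qed.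

Definition tens_functor : functor (rmodules A) M.
Proof.
refine (@Functor k (rmodules A) M tens tensm _ _).
- move=> V; apply: tensq_epi; rewrite tensmE comp1m.
  by rewrite -[RHS]compm1 -actm1.
move=> U V W g f; apply: tensq_epi; rewrite tensmE -compmA tensmE compmA tensmE.
by rewrite -[RHS]compmA -actmD comp1m.
Defined.

Lemma unit_commutes (V : rmodules A) :
  @rm_commutes k C A V (Hom_G (tens V)) (icur H (tensq V)).
Proof.
apply: evA_inj; rewrite !arrE !arr_actDl //.
rewrite !acompA evA_icur evA_act tensq_balanced -acompA arr_actA -ida_act actRL //.
rewrite -(actLR (f := Arr (icur _ _)) (X := rm_ob V) (N := G)) //.
by rewrite acompA evA_icur.
Qed.

Definition tens_unit (V : rmodules A) : mor V (Hom_G (tens V)) :=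
  RmHom (unit_commutes V).

(** Through [ihom_a], [[G, -]] turns the cokernel defining [tens V] into the
    bar presentation [V \ten A \ten A -> V \ten A -> V], in which the unit of [A]
    splits the last map. *)
Lemma tens_unit_iso (V : rmodules A) : is_iso (tens_unit V).
Proof.
apply: rm_iso; rewrite /tens_unit /rm_hom_val /=.
set u := icur H (tensq V).
pose K := imap H (idm G); pose a X N := ihom_a H X G N.
have a_inv X N : inverse_of (a X N) (invm (a X N)) by exact: invmP (ihom_a_iso _ _ _ _).
have Kq : K _ _ (tensq V) \c a (rm_ob V) G = u \c rm_act V.
  apply: evA_inj; rewrite !arrE !arr_actDl // !acompA evA_imap1 evA_icur.
  by rewrite (tensq_balanced V) -acompA evA_a.
have [aK Ka] : inverse_of (a (rm_ob V) G) (invm (a (rm_ob V) G)) by exact: a_inv.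
have Kact : K _ _ (rm_act V \actm idm G) \c a (rm_ob V \ten A) G
    = a (rm_ob V) G \c (rm_act V \tenm idm [G, G]).
  by rewrite -ihom_a_natural imap1.
have Kev : K _ _ ((idm (rm_ob V) \actm iev H G G) \c idto (actA (rm_ob V) A G))
      \c a (rm_ob V \ten A) G
    = a (rm_ob V) G \c (idm (rm_ob V) \tenm mu A) \c idto (tenA (rm_ob V) A A).
  apply: evA_inj; rewrite (Arr_comp (K _ _ _)) Arr_idtor (Arr_comp (a _ _)).
  rewrite !arr_actDl // !acompA evA_imap1 evA_a -acompA evA_a Arr_comp Arr_idto.
  rewrite acomp1; last ends.
  rewrite !Arr_act Arr_ten !arr_actA Arr_idm ida_ten arr_actA -!arr_actDr //.
  by rewrite evA_act.
have [|w [wq _]] := (imap1_coker (tensqP V)).2 _ (rm_act V \c invm (a (rm_ob V) G)).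
  rewrite /act_diff imap1B compmB; apply/eqP; rewrite subr_eq0; apply/eqP.
  have [_ Ka'] := a_inv (rm_ob V \ten A) G.
  rewrite -[LHS]compm1 -[RHS]compm1 -Ka' -!compmA (compmA (K _ _ _)) Kact.
  rewrite (compmA (K _ _ _)) Kev -!compmA !(compmA (invm _) (a _ _)) aK !comp1m.
  by rewrite !compmA rm_actA.
have {}wq : w \c K _ _ (tensq V) \c a (rm_ob V) G = rm_act V.
  by rewrite wq -compmA aK compm1.
exists w; split.
  have wu : w \c u \c rm_act V = rm_act V by rewrite -compmA -Kq compmA.
  have := congr1 (fun x => Arr (x \c (idm (rm_ob V) \tenm ihom_unit H G))) wu.
  rewrite -(compmA (w \c u)) (rm_act1 V) Arr_idtor Arr_idto ten1r => E.
  exact: Arr_inj.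
apply: (coker_epi (imap1_coker (tensqP V))).
rewrite comp1m -[LHS]compm1 -[RHS]compm1 -Ka !compmA; congr (_ \c _).
by rewrite -(compmA (u \c w)) -(compmA u) (compmA w) wq Kq.
Qed.

Lemma iev_balanced (N : M) : balanced (V := Hom_G N) (iev H G N).
Proof. exact: evA_act. Qed.

Definition tens_counit (N : M) : mor (tens (Hom_G N)) N := tens_desc (iev_balanced N).

Lemma tens_counitE (N : M) : tens_counit N \c tensq (Hom_G N) = iev H G N.
Proof. exact: tens_descE. Qed.

Lemma tens_counit_unit (N : M) :
  imap H (idm G) (tens_counit N) \c icur H (tensq (Hom_G N)) = idm [G, N].
Proof. by rewrite imap1_icur tens_counitE -[RHS](icur_iev (i := H)) actm1 compm1. Qed.

(** [Hom(G, f)] is [Hom(1, [G, f])], as [G] is [1 \act G]. *)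
Lemma ihom_reflects_iso (N L : M) (f : mor N L) :
  is_iso (imap H (idm G) f) -> is_iso f.
Proof.
move=> [f' [f'f ff']]; apply: Gdet => g.
have [s sE] := icur_surjective (f' \c icur H (g \c idto (act1 G))).
have fs : f \c s = g \c idto (act1 G).
  by apply: icur_injective; rewrite -imap1_icur sE compmA ff' comp1m.
have idtoK : idto (act1 G) \c idto (esym (act1 G)) = idm G.
  by rewrite idto_comp idto_id.
exists (s \c idto (esym (act1 G))); split.
  by rewrite compmA fs -compmA idtoK compm1.
move=> h hE; have -> : s = h \c idto (act1 G).
  apply: icur_injective; rewrite sE -hE -compmA -imap1_icur compmA f'f comp1m //.
by rewrite -compmA idtoK compm1.
Qed.

(** By the triangle identity [[G, -]] sends the counit to the inverse of a unit. *)
Lemma tens_counit_iso (N : M) : is_iso (tens_counit N).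
Proof.
apply: ihom_reflects_iso.
have [v [vu uv]] := tens_unit_iso (Hom_G N).
have {vu uv} [vu uv] : inverse_of (icur H (tensq (Hom_G N))) (rm_hom_val v).
  by split; [have := congr1 (fun f => rm_hom_val f) vu | have := congr1 (fun f => rm_hom_val f) uv].
have <- : rm_hom_val v = imap H (idm G) (tens_counit N).
  by rewrite -[LHS]comp1m -(tens_counit_unit N) -compmA uv compm1.
by exists (icur H (tensq (Hom_G N))).
Qed.

Lemma tens_unit_natural (V W : rmodules A) (f : mor V W) :
  tens_unit W \c f = fmap Hom_G (tensm f) \c tens_unit V.
Proof.
apply: rm_hom_inj; change (icur H (tensq W) \c rm_hom_val f
  = imap H (idm G) (tensm f) \c icur H (tensq V)).
rewrite imap1_icur tensmE; apply: evA_inj.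
by rewrite evA_icur (Arr_comp (icur _ _)) arr_actDl // acompA evA_icur Arr_comp.
Qed.

Lemma tens_counit_natural (N L : M) (f : mor N L) :
  tens_counit L \c tensm (fmap Hom_G f) = f \c tens_counit N.
Proof.
apply: tensq_epi; rewrite -!compmA tensmE compmA !tens_counitE.
change (iev H G L \c (imap H (idm G) f \actm idm G) = f \c iev H G N).
by rewrite iev_icur actm1 compm1.
Qed.

Lemma ihom_equivalence : is_equivalence Hom_G.
Proof.
exists tens_functor; split.
  exists (fun N => invm (tens_counit N)); split.
    move=> N L f; apply: invm_nat (tens_counit_iso _) (tens_counit_iso _) _.
    exact: tens_counit_natural.
  by move=> N; apply: invm_iso; exact: tens_counit_iso.
exists (fun V => invm (tens_unit V)); split.
  move=> V W f; apply: invm_nat (tens_unit_iso _) (tens_unit_iso _) _.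
  exact: tens_unit_natural.
by move=> V; apply: invm_iso; exact: tens_unit_iso.
Qed.

End TensorOver.

Theorem ihom_module_equivalent : module_equivalent M (rmodules A).
Proof.
exists Hom_G, (ihom_structure H G); split.
- exact: ihom_functor_linear.
- exact: ihom_equivalence.
- by move=> X X' N L f g; apply: rm_hom_inj; exact: ihom_a_natural.
- by move=> X N; apply: rm_iso; exact: ihom_a_iso.
split.
  move=> X Y N; apply: rm_hom_inj.
  change (imap H (idm G) (idto (actA X Y N)) \c ihom_a H (X \ten Y) G N
    = ihom_a H X G (Y \act N) \c (idm X \tenm ihom_a H Y G N)
      \c rm_hom_val (idto (actA X Y (Hom_G N)))).
  by rewrite ihom_aA rm_hom_val_idto; congr (_ \c _); apply: idto_irr.
move=> N; apply: rm_hom_inj.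
change (imap H (idm G) (idto (act1 N)) \c ihom_a H tunit G N
  = rm_hom_val (idto (act1 (Hom_G N)))).
by rewrite ihom_a1 rm_hom_val_idto; apply: idto_irr.
Qed.

End Morita.

(** * The symmetric Frobenius form *)

Section FrobeniusForm.
Variables (k : fieldType) (C : rigidCategory k) (M : modCategory C).
Variables (H : internal_hom M) (S : relative_serre H) (x : serre_module_structure S).
Variables (p : pivotal_structure C) (pt : module_pivotal_structure p x).
Variable G : M.
Local Notation evA := (evA H).
Local Notation "[ N , L ]" := (iob H N L).
Local Notation A := [G, G].
Local Notation act N := (ihom_act H G N).
Local Notation m := (ihom_act H G G).

(** The Frobenius map, obtained from Serre duality before the form it comes from. *)
Definition frob : mor A (ld A) := serre_phi S G G \c imap H (idm G) (mpiv pt G).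

Lemma iso_imap1 (N L : M) (f : mor N L) : is_iso f -> is_iso (imap H (idm G) f).
Proof.
move=> [g [gf fg]]; exists (imap H (idm G) g).
by split; rewrite -imap1D ?gf ?fg imap1.
Qed.

Lemma frob_iso : is_iso frob.
Proof. by apply: iso_comp (serre_phi_iso _ _ _) (iso_imap1 (mpiv_iso _ _)). Qed.

Section RightLinear.

(* The action of [A] on [G], with the strand of [A] bent to the target. *)
Let g0 : mor G (rd A \act G) :=
  (idm (rd A) \actm iev H G G) \c idto (actA _ _ _) \c (coevr A \actm idm G)
    \c idto (esym (act1 G)).

Let g0E : Arr g0 = (ida (rd A) \ac evA G G) \co (Arr (coevr A) \ac G).
Proof. by rewrite /g0 !arrE. Qed.

(** Bending the strand of [A] to the target by [g0] and back by [ihom_b]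
    straightens it, leaving composition. *)
Lemma imap_coaction_b (N : M) : imap H g0 (idm N) \c ihom_b H G N A = act N.
Proof.
apply: evA_inj; rewrite evA_act Arr_comp arr_actDl // acompA evA_imap.
rewrite acomp1l // -acompA (actRL (f := Arr (ihom_b _ _ _ _))) //.
rewrite -(actLR (X := [G, N] \ten A) (N := rd A \act G)) // acompA evA_b -acompA.
congr (_ \co _).
rewrite ida_ten arr_actA -!arr_actDr; try ends; congr (_ \ac _).
rewrite g0E arr_actDr; last ends.
rewrite acompA.
rewrite -(arr_actA A (rd A)) -ida_ten -(act_ev_slide (evr A) (iev H G G)).
rewrite -acompA ida_act -[X in _ \co (X \co _)]arr_actA -[X in _ \co (_ \co X)]arr_actA.
rewrite -arr_actDl ?zig_evr; last ends.
by rewrite -ida_act acomp1.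
Qed.

(* Left multiplication on [A], with the strand of the left factor bent to the
   target: the counterpart of [g0] on internal Homs. *)
Let r : mor A (rd A \ten A) :=
  (idm (rd A) \tenm m) \c idto (tenA _ _ _) \c (coevr A \tenm idm A)
    \c idto (esym (ten1l A)).

Let rE : Arr r = (rd A \ox Arr m) \co (Arr (coevr A) \ox A).
Proof. by rewrite /r !arrE. Qed.

Lemma a_coaction : ihom_a H (rd A) G G \c r = imap H (idm G) g0.
Proof.
apply: evA_inj; rewrite evA_imap1 Arr_comp arr_actDl // acompA evA_a.
rewrite rE g0E arr_actDl; last ends.
rewrite acompA !arr_actA -arr_actDr // evA_act arr_actDr //.
rewrite -!acompA; congr (_ \co _).
rewrite -(arr_actA (rd A)) -ida_ten -ida_act.
by rewrite -(act_coev_slide (coevr A) (iev H G G)).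
Qed.

(** Right linearity of [frob]: [dualm r] is the right action of [A] on [ld A].
    Naturality along [g0] turns composition into [ihom_b], on which the Serre
    isomorphism is compatible with the right module structures. *)
Lemma frob_act :
  frob \c m = dualm r \c idto (ld_ten_rd A A) \c (frob \tenm idm A).
Proof.
have aI : is_iso (ihom_a H (rd A) G G) by exact: ihom_a_iso.
have -> : r = invm (ihom_a H (rd A) G G) \c imap H (idm G) g0.
  by rewrite -a_coaction compmA (invmP aI).1 comp1m.
rewrite dualm_comp /frob -[in LHS]compmA.
rewrite -[idm A]comp1m tenmD.
have -> : imap H (idm G) (mpiv pt G) \c m
    = act (S G) \c (imap H (idm G) (mpiv pt G) \tenm idm A) by exact: imap1_commutes.
rewrite -imap_coaction_b compmA compmA.
have := serre_phi_natural S (idm G) g0; rewrite fmap1 => ->.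
rewrite -[_ \c _ \c ihom_b _ _ _ _]compmA (serre_phi_module S G G A).
by rewrite !compmA.
Qed.

(** Evaluation moves [dualm r] to [r] on the other strand, where a zigzag
    straightens the bent strand of [A]. *)
Lemma ev_frob_act :
  Arr (ev A) \co ((Arr frob \co Arr m) \ox A) = Arr (ev A) \co (Arr frob \ox Arr m).
Proof.
have -> : Arr frob \co Arr m = Arr (dualm r) \co (Arr frob \ox A).
  rewrite -Arr_comp frob_act (Arr_comp (_ \c _)) (Arr_comp (dualm r)) Arr_idto.
  by rewrite (acomp1 (f := Arr (dualm r))) //= ld_ten_rd.
rewrite arr_tenDl; last ends.
rewrite acompA ev_dualm Arr_ev_ten -Arr_evr ld_ten ld_rd.
rewrite ida_ten !arr_tenA -ida_ten.
have rK : (Arr (evr A) \ox A) \co (A \ox Arr r) = Arr m.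
  rewrite rE arr_tenDr; last ends.
  rewrite acompA -(arr_tenA A (rd A)) -ida_ten -(ev_slide (evr A) m).
  rewrite -acompA ida_ten -arr_tenA -[A \ox (_ \ox A)]arr_tenA -arr_tenDl; last ends.
  by rewrite zig_evr -ida_ten acomp1.
rewrite -(acompA (Arr (ev A))) -arr_tenDr ?rK; last ends.
by rewrite -acompA tenRL.
Qed.

End RightLinear.

Definition frob_form : mor A tunit :=
  ev A \c ((frob \c ihom_unit H G) \tenm idm A) \c idto (esym (ten1l A)).

Lemma frob_formE : Arr frob_form = Arr (ev A) \co ((Arr frob \co Arr (ihom_unit H G)) \ox A).
Proof. by rewrite /frob_form Arr_idtor Arr_comp Arr_ten (Arr_comp frob). Qed.

(** Right linearity of [frob] applied at the unit in the first factor. *)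
Lemma frob_form_mul : Arr frob_form \co Arr m = Arr (ev A) \co (Arr frob \ox A).
Proof.
rewrite frob_formE -acompA -[Arr m in LHS]arr_ten1l tenLR //.
have := congr1 (fun f => f \co (Arr (ihom_unit H G) \ox A \ox A)) ev_frob_act.
rewrite -!acompA -arr_tenDl // -acompA.
have -> : Arr m \co (Arr (ihom_unit H G) \ox A) = A.
  by rewrite -Arr_ten -Arr_comp ihom_act1l Arr_idto ten1l.
rewrite acomp1 // => ->; congr (_ \co _).
rewrite arr_tenA -ida_ten -(tenRL (f := Arr frob) (X := ld A) (Y := A \ten A)) //.
rewrite -acompA -arr_tenDl // tenRL //.
Qed.

Lemma frobenius_map_frob : @frobenius_map k C (end_algebra H G) frob_form = frob.
Proof.
apply: Arr_inj; rewrite /frobenius_map /= !Arr_idtor Arr_comp !Arr_idtor Arr_idtol.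
rewrite !Arr_ten Arr_comp frob_form_mul arr_tenDl // -acompA arr_tenA -ida_ten.
by rewrite -(coev_slider (coev A) frob) acompA zag_ev acomp1l.
Qed.

Section LeftLinear.

Let e := f_equal (iob H ^~ G) (esym (rd_ld_act A G)).

(* Multiplication on [A], with the strand of the right factor bent to the target. *)
Let c : mor A (A \ten ld A) :=
  (m \tenm idm (ld A)) \c idto (esym (tenA _ _ _)) \c (idm A \tenm coev A)
    \c idto (esym (ten1r A)).

Let cE : Arr c = (Arr m \ox ld A) \co (A \ox Arr (coev A)).
Proof. by rewrite /c !arrE. Qed.

(** The transport [e] along [rd (ld A) = A] is there because [ihom_b] is taken at
    [ld A] and produces an internal Hom out of [rd (ld A) \act G]. *)
Lemma b_coaction : ihom_b H G G (ld A) \c c = idto e \c imap H (iev H G G) (idm G).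
Proof.
apply: evA_inj; rewrite Arr_comp arr_actDl // acompA.
rewrite evA_b Arr_idtol Arr_evr_ld rd_ld_act evA_imap acomp1l //.
rewrite -acompA.
have cK : (A \ox Arr (ev A)) \co (Arr c \ox A) = Arr m.
  rewrite cE arr_tenDl; last ends.
  rewrite acompA arr_tenA -ida_ten -(ev_slider (ev A) m) -acompA ida_ten !arr_tenA.
  by rewrite -arr_tenDr ?zig_ev; [rewrite -ida_ten acomp1 | ends].
rewrite ida_act -(arr_actA A (Arr (ev A))) -(arr_actA (Arr c)) -arr_actDl; last ends.
by rewrite cK evA_act.
Qed.

Lemma act_imap : m = imap H (idm G) (iev H G G) \c ihom_a H A G G.
Proof.
apply: evA_inj; rewrite evA_act Arr_comp arr_actDl // acompA evA_imap1.
by rewrite -acompA evA_a.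
Qed.

(** Left linearity of [frob] up to [p]: [dualm c] is the left action of the
    double dual of [A] on [ld A]. Composition is [ihom_a] followed by the action
    [A \act G -> G], so naturality along that action reduces the claim to the
    object [A \act G], where the pivotal structure is given by that of [G]
    through the twisted module structure. *)
Lemma frob_act_twisted :
  frob \c m = dualm c \c idto (ldld_ten_ld A A) \c (p A \tenm frob).
Proof.
have bI : is_iso (ihom_b H G G (ld A)) by exact: ihom_b_iso.
have -> : c = invm (ihom_b H G G (ld A)) \c (idto e \c imap H (iev H G G) (idm G)).
  by rewrite -b_coaction compmA (invmP bI).1 comp1m.
rewrite !dualm_comp /frob act_imap compmA -(compmA _ (imap _ _ _) (imap _ _ _)) -imap1D.
rewrite mpiv_natural imap1D compmA (serre_phi_natural S (iev H G G) (idm G)).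
rewrite mpiv_act imap1D.
rewrite -[LHS]compmA -(compmA (imap _ _ (x _ _))) -ihom_a_natural.
rewrite !compmA -(compmA (dualm _)) -(compmA (dualm _)) (xi_phi x).
rewrite -[X in _ = _ \c (X \tenm _)]comp1m tenmD.
by rewrite !compmA.
Qed.

Lemma frob_form_coaction : (Arr frob_form \ox ld A) \co Arr c = Arr frob.
Proof.
rewrite -[in RHS]frobenius_map_frob /frobenius_map /= Arr_idtor Arr_comp Arr_idtor.
rewrite Arr_idtol Arr_ten Arr_comp (Arr_ten (idm A)) cE acompA -arr_tenDl //.
Qed.

(** Twisted left linearity at the unit: [frob a] at [b] is [p a] applied to the
    functional [x |-> frob 1 (b x)], which is [frob b]. *)
Lemma frob_symmetric : dualm frob \c p A = frob.
Proof.
set u := ihom_unit H G.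
have fE : Arr frob = Arr (dualm c) \co (Arr (p A) \ox (Arr frob \co Arr u)).
  have -> : Arr (p A) \ox (Arr frob \co Arr u)
      = (Arr (p A) \ox Arr frob) \co (A \ox Arr u).
    by rewrite -arr_tenD // acomp1.
  have mu1 : Arr m \co (A \ox Arr u) = A.
    have := congr1 Arr (ihom_act1 H G G).
    by rewrite Arr_comp Arr_idto Arr_ten => ->; rewrite ten1r.
  have fm : Arr frob \co Arr m = Arr (dualm c) \co (Arr (p A) \ox Arr frob).
    rewrite -Arr_comp frob_act_twisted (Arr_comp _ (_ \tenm _)) (Arr_comp (dualm c)).
    by rewrite Arr_idto (acomp1 (f := Arr (dualm c))) //= ld_ten.
  by rewrite acompA -fm -acompA mu1 acomp1.
apply: Arr_inj; apply: (dual_ext (X := A)) => //.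
rewrite (Arr_comp (dualm frob)) arr_tenDl // acompA ev_dualm [in RHS]fE.
rewrite arr_tenDl; last ends.
rewrite acompA ev_dualm Arr_ev_ten ld_ten ida_ten.
rewrite -[in LHS]acompA tenRL // !arr_tenA -(acompA (Arr (ev (ld A)))) -arr_tenDr; last ends.
rewrite -acompA -arr_tenD; try ends.
rewrite acomp1l //; congr (_ \co (_ \ox _)).
rewrite -acompA tenRL // -(tenLR (f := _ \co _) (X := tunit) (Y := A \ten ld A)) // arr_ten1l.
rewrite ida_ten -arr_tenA acompA -arr_tenDl; last ends.
by rewrite -frob_formE frob_form_coaction.
Qed.

End LeftLinear.

Lemma end_algebra_symmetric_frobenius :
  @is_symmetric_frobenius k C (end_algebra H G) frob_form p.
Proof.
rewrite /is_symmetric_frobenius /is_frobenius /nakayama frobenius_map_frob.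
split; first exact: frob_iso.
by rewrite -compmA frob_symmetric (invmP frob_iso).1.
Qed.

End FrobeniusForm.

Theorem corollary3p16 (k : fieldType) (C : pivotalFTC k)
    (M : pivotalModCategory C) :
  exists (A : algebra C) (lambda : mor (alg_ob A) tunit),
    is_symmetric_frobenius lambda (pft_piv C) /\
    module_equivalent M (rmodules A).
Proof.
have [[Mfin _ _] Mexact] := pmc_exact M.
have [G [_ Gdet]] := progenerator_exists Mfin.
exists (end_algebra (pmc_ihom M) G), (frob_form (pmc_piv M) G); split.
  exact: end_algebra_symmetric_frobenius.
exact: ihom_module_equivalent (ftc_finite C) Mfin Mexact Gdet.
Qed.
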